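(* Let $f(z)=z+\sum_{n=2}^{\infty}a_nz^n$ belong to $\mathcal{S}^*_{ch}$, and let $$\Gamma_1=-\tfrac12 a_2,\qquad \Gamma_2=-\tfrac12\Big(a_3-\tfrac32 a_2^2\Big),\qquad \Gamma_3=-\tfrac12\Big(a_4-4a_2a_3+\tfrac{10}{3}a_2^3\Big)$$ be its first three logarithmic inverse coefficients. Then $$|H_{2,1}(F_{f^{-1}}/2)|=|\Gamma_1\Gamma_3-\Gamma_2^2|=\tfrac1{48}\left|13a_2^4-12a_2^2a_3-12a_3^2+12a_2a_4\right|\le\frac{3}{44},$$ and the inequality is sharp (there is a function in $\mathcal{S}^*_{ch}$ for which equality holds).
   Context: $\mathbb{D}=\{z\in\mathbb{C}:|z|<1\}$. $\mathcal{A}$ is the class of analytic $f$ on $\mathbb{D}$ with $f(0)=0$, $f'(0)=1$. For analytic $g,h$ on $\mathbb{D}$, $g\prec h$ means there is an analytic $\omega$ on $\mathbb{D}$ with $\omega(0)=0$, $|\omega(z)|<1$, and $g=h\circ\omega$. $\mathcal{S}^*_{ch}$ is the class of $f\in\mathcal{A}$ with $\frac{zf'(z)}{f(z)}\prec z+\cosh z$ on $\mathbb{D}$. The logarithmic inverse coefficients $\Gamma_n$ are defined by $F_{f^{-1}}(w):=\log\frac{f^{-1}(w)}{w}=2\sum_{n\ge1}\Gamma_nw^n$ for $w$ near $0$, and $H_{2,1}(F_{f^{-1}}/2):=\Gamma_1\Gamma_3-\Gamma_2^2$. *)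

(* Defs.v *)
From Stdlib Require Import Reals.
From Coquelicot Require Import Coquelicot.
Open Scope R_scope.

Definition inD (z : C) : Prop := Cmod z < 1.

Definition analytic_on_D (f : C -> C) : Prop :=
  exists c : nat -> C, forall z, inD z -> is_pseries c z (f z).

Definition Ccosh (z : C) : C :=
  (cosh (fst z) * cos (snd z), sinh (fst z) * sin (snd z)).

Definition phi_ch (z : C) : C := (z + Ccosh z)%C.

Definition classA (f : C -> C) : Prop :=
  analytic_on_D f /\ f 0%C = 0%C /\ is_derive (K := C_AbsRing) (V := C_NormedModule) f (RtoC 0) (RtoC 1).

(** Subordination z f'(z)/f(z) ≺ z + cosh z on D: there is a Schwarz function
    omega (analytic on D, omega(0)=0, |omega|<1) such that for every z in D,
    z <> 0, f z <> 0 and z f'(z)/f(z) = phi(omega z).  (At z = 0 the quotient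
    z f'/f has a removable singularity with value f'(0)/f'(0)=1=phi(omega 0).) *)
Definition Sch (f : C -> C) : Prop :=
  classA f /\
  exists omega : C -> C,
    analytic_on_D omega /\ omega 0%C = 0%C /\
    (forall z, inD z -> Cmod (omega z) < 1) /\
    (forall z, inD z -> z <> 0%C ->
       f z <> 0%C /\
       exists d : C, is_derive (K := C_AbsRing) (V := C_NormedModule) f z d /\
                     (z * d / f z)%C = phi_ch (omega z)).

Definition Gamma1 (a : nat -> C) : C := (- (1/2) * a 2%nat)%C.
Definition Gamma2 (a : nat -> C) : C :=
  (- (1/2) * (a 3%nat - (3/2) * (a 2%nat * a 2%nat)))%C.
Definition Gamma3 (a : nat -> C) : C :=
  (- (1/2) * (a 4%nat - 4 * a 2%nat * a 3%nat
              + (10/3) * (a 2%nat * a 2%nat * a 2%nat)))%C.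

Definition H21 (a : nat -> C) : C :=
  (Gamma1 a * Gamma3 a - Gamma2 a * Gamma2 a)%C.

(* Main.v *)
(** With zf'/f = phi(omega) and omega = w_1 z + w_2 z^2 + w_3 z^3 + ..., comparing
    coefficients gives
      48 H = 9/4 w_1^4 - 5 w_1^2 w_2 - 3 w_2^2 + 4 w_1 w_3.
    The power series of cosh(omega) comes from that of exp(omega), the solution of
    E' = omega' E, so no composition of power series is needed.

    Parseval over roots of unity, applied to |omega p| <= |p| with p quadratic, yields
    Schur's inequalities for w_1, w_2, w_3; they eliminate w_3. With u = |w_1|^2 and
    |w_2| = (1 - u) t, what remains is the maximum of an explicit function of u, t and
    Re(w_1^2 conj w_2). It equals 36/11, at u = 2/11 and t = 1, and is attained for
    omega = z (z + c) / (1 + c z) with c^2 = 2/11. The corresponding f is z h, where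
    h' = h (phi(omega) - 1) / z. *)
Require Import Defs.
From Stdlib Require Import Reals.
From Coquelicot Require Import Coquelicot.
From Stdlib Require Import Lra Lia Psatz.
Open Scope R_scope.

(** * Complex series and derivatives *)

(** The constants come from the extremal configuration. At t = 1 the third Schur inequality forces
    w_3 = - conj(w_1) w_2^2 / (1 - u). If moreover w_2 is a positive multiple of w_1^2, then 48 |H|
    = |3 + 3u - (33/4) u^2|, a parabola with vertex u = 2/11 and value 36/11 there; 36/11 divided by
    48 is 3/44. For t < 1 the freedom left in w_3 contributes at most 4 |w_1| (1 - u) (1 - t^2).
    Since 4 |w_1| <= 3 + u, this gain is covered by what the y^2 term loses, so splitting it off by
    the triangle inequality keeps the bound sharp. The obstacle is the phase between w_1^2 and w_2:
    alignment is optimal only while u is small compared with t, and beyond that range a cruder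
    bound, uniform in the phase, has to stay below 36/11. The equation h' = q h serves two
    constructions, exp(omega) and h. Both rest on one fact: solutions for q and for -q have a
    constant product. *)

Fixpoint csum (a : nat -> C) (n : nat) : C :=
  match n with O => 0%C | S m => (csum a m + a m)%C end.

Fixpoint rsum (a : nat -> R) (n : nat) : R :=
  match n with O => 0 | S m => rsum a m + a m end.

(** An epsilon form with [Cmod], suited to direct estimates. [csum a n] has n terms while
    [sum_n a n] has n + 1, hence the shifts by [S] in the translation to [is_series]. *)
Definition cser (a : nat -> C) (l : C) : Prop :=
  forall eps, 0 < eps ->
    exists N, forall n, (N <= n)%nat -> Cmod (csum a n - l) < eps.

Definition has_pseries (a : nat -> C) (f : C -> C) : Prop :=
  forall z, inD z -> cser (fun n => a n * z ^ n)%C (f z).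

Definition cderiv (f : C -> C) (z d : C) : Prop :=
  forall eps, 0 < eps -> exists del, 0 < del /\
    forall w, Cmod (w - z) < del ->
      Cmod (f w - f z - d * (w - z)) <= eps * Cmod (w - z).

Lemma Cmod_triangle_sub (x y z : C) : Cmod (x - z) <= Cmod (x - y) + Cmod (y - z).
Proof.
  replace (x - z)%C with ((x - y) + (y - z))%C by ring. apply Cmod_triangle.
Qed.

Lemma Cmod_minus_sym (x y : C) : Cmod (x - y) = Cmod (y - x).
Proof. rewrite <- (Cmod_opp (x - y)). f_equal. ring. Qed.

Lemma csum_ext (a b : nat -> C) (n : nat) :
  (forall k, (k < n)%nat -> a k = b k) -> csum a n = csum b n.
Proof.
  induction n as [|n IH]; intros H; simpl; [reflexivity|].
  rewrite IH by (intros; apply H; lia). rewrite H by lia. reflexivity.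
Qed.

Lemma csum_plus (a b : nat -> C) (n : nat) :
  csum (fun k => a k + b k)%C n = (csum a n + csum b n)%C.
Proof. induction n as [|n IH]; simpl; [ring|]. rewrite IH. ring. Qed.

Lemma csum_scal (x : C) (a : nat -> C) (n : nat) :
  csum (fun k => x * a k)%C n = (x * csum a n)%C.
Proof. induction n as [|n IH]; simpl; [ring|]. rewrite IH. ring. Qed.

Lemma csum_zero (n : nat) : csum (fun _ => 0%C) n = 0%C.
Proof. induction n as [|n IH]; simpl; [reflexivity|]. rewrite IH. ring. Qed.

Lemma csum_swap (a : nat -> nat -> C) (m n : nat) :
  csum (fun i => csum (a i) n) m = csum (fun j => csum (fun i => a i j) m) n.
Proof.
  induction m as [|m IH]; simpl.
  - now rewrite csum_zero.
  - rewrite IH, <- csum_plus. reflexivity.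
Qed.

Lemma csum_first (a : nat -> C) (n : nat) :
  csum a (S n) = (a O + csum (fun k => a (S k)) n)%C.
Proof.
  induction n as [|n IH]; [simpl; ring|].
  change (csum a (S (S n))) with (csum a (S n) + a (S n))%C.
  rewrite IH. simpl. ring.
Qed.

Lemma rsum_first (a : nat -> R) (n : nat) :
  rsum a (S n) = a O + rsum (fun k => a (S k)) n.
Proof.
  induction n as [|n IH]; [simpl; ring|].
  change (rsum a (S (S n))) with (rsum a (S n) + a (S n)).
  rewrite IH. simpl. ring.
Qed.

Lemma Cmod_csum_le (a : nat -> C) (b : nat -> R) (n : nat) :
  (forall k, (k < n)%nat -> Cmod (a k) <= b k) -> Cmod (csum a n) <= rsum b n.
Proof.
  induction n as [|n IH]; intros H; simpl.
  - rewrite Cmod_0. lra.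
  - eapply Rle_trans; [apply Cmod_triangle|].
    apply Rplus_le_compat; [apply IH; intros; apply H; lia|apply H; lia].
Qed.

Lemma rsum_le (a b : nat -> R) (n : nat) :
  (forall k, (k < n)%nat -> a k <= b k) -> rsum a n <= rsum b n.
Proof.
  induction n as [|n IH]; intros H; simpl; [lra|].
  apply Rplus_le_compat; [apply IH; intros; apply H; lia|apply H; lia].
Qed.

Lemma rsum_scal (x : R) (a : nat -> R) (n : nat) :
  rsum (fun k => x * a k) n = x * rsum a n.
Proof. induction n as [|n IH]; simpl; [ring|]. rewrite IH. ring. Qed.

Lemma rsum_incr (a : nat -> R) (m n : nat) :
  (forall k, 0 <= a k) -> (m <= n)%nat -> rsum a m <= rsum a n.
Proof.
  intros Ha H; induction H; simpl; [lra|]. specialize (Ha m0). lra.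
Qed.

Lemma rsum_sum_n (a : nat -> R) (n : nat) : rsum a (S n) = sum_n a n.
Proof.
  induction n as [|n IH]; [rewrite sum_O; simpl; ring|].
  rewrite sum_Sn, <- IH. reflexivity.
Qed.

Lemma csum_sum_n (a : nat -> C) (n : nat) :
  csum a (S n) = sum_n (G := C_AbelianGroup) a n.
Proof.
  induction n as [|n IH]; [rewrite sum_O; simpl; ring|].
  rewrite sum_Sn, <- IH. reflexivity.
Qed.

Lemma is_series_cser (a : nat -> C) (l : C) :
  is_series (K := C_AbsRing) (V := C_NormedModule) a l <-> cser a l.
Proof.
  split.
  - intros H eps Heps.
    assert (L := proj1 (filterlim_locally_ball_norm (K := C_AbsRing)
      (U := C_NormedModule) (F := eventually) _ _) H (mkposreal _ Heps)).
    destruct L as [N HN]. exists (S N). intros [|n] Hn; [lia|].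
    rewrite csum_sum_n. apply (HN n). lia.
  - intros H.
    apply (proj2 (filterlim_locally_ball_norm (K := C_AbsRing)
      (U := C_NormedModule) (F := eventually) (sum_n (G := C_AbelianGroup) a) l)).
    intros eps. destruct (H eps (cond_pos eps)) as [N HN].
    exists N. intros n Hn. specialize (HN (S n)).
    rewrite csum_sum_n in HN. apply HN. lia.
Qed.

Lemma is_series_rsum (a : nat -> R) (l : R) :
  is_series a l <-> (forall eps, 0 < eps ->
    exists N, forall n, (N <= n)%nat -> Rabs (rsum a n - l) < eps).
Proof.
  rewrite is_series_Reals. split; intros H eps Heps; destruct (H eps Heps) as [N HN].
  - exists (S N). intros [|n] Hn; [lia|].
    rewrite rsum_sum_n, sum_n_Reals. apply HN. lia.
  - exists N. intros n Hn. unfold Rfunctions.Rdist.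
    rewrite <- sum_n_Reals, <- rsum_sum_n. apply HN. lia.
Qed.

Lemma pow_n_Cpow (z : C) (n : nat) : pow_n (K := C_Ring) z n = (z ^ n)%C.
Proof.
  induction n as [|n IH]; [reflexivity|].
  change (Cmult z (pow_n (K := C_Ring) z n) = (z * z ^ n)%C). now rewrite IH.
Qed.

Lemma is_pseries_cser (a : nat -> C) (z l : C) :
  is_pseries (K := C_AbsRing) (V := C_NormedModule) a z l <-> cser (fun n => a n * z ^ n)%C l.
Proof.
  rewrite <- is_series_cser. unfold is_pseries.
  assert (E : forall n, scal (K := C_AbsRing) (V := C_NormedModule)
    (pow_n (K := C_AbsRing) z n) (a n) = (a n * z ^ n)%C).
  { intros n. change (Cmult (pow_n (K := C_Ring) z n) (a n) = (a n * z ^ n)%C).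
    rewrite pow_n_Cpow. ring. }
  split; apply is_series_ext; intros n; rewrite E; reflexivity.
Qed.

Lemma has_pseries_iff (a : nat -> C) (f : C -> C) :
  has_pseries a f <-> (forall z, inD z -> is_pseries a z (f z)).
Proof.
  split; intros H z Hz; apply is_pseries_cser, H, Hz.
Qed.

Lemma cser_unique (a : nat -> C) (l m : C) : cser a l -> cser a m -> l = m.
Proof.
  rewrite <- !is_series_cser. apply filterlim_locally_unique.
Qed.

Lemma is_derive_cderiv (f : C -> C) (z d : C) :
  is_derive (K := C_AbsRing) (V := C_NormedModule) f z d <-> cderiv f z d.
Proof.
  split.
  - intros [_ H] eps Heps.
    destruct (H z (fun P HP => HP) (mkposreal _ Heps)) as [del Hdel].
    exists del. split; [apply cond_pos|]. intros w Hw.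
    replace (d * (w - z))%C with ((w - z) * d)%C by ring.
    exact (Hdel w Hw).
  - intros H. split; [apply (is_linear_scal_l (K := C_AbsRing) (V := C_NormedModule))|].
    intros x Hx eps.
    apply (is_filter_lim_locally_unique (K := C_AbsRing) (V := AbsRing_NormedModule C_AbsRing)) in Hx.
    rewrite <- Hx in *. destruct (H eps (cond_pos eps)) as [del [Hd Hdel]].
    exists (mkposreal _ Hd). intros w Hw.
    assert (E := Hdel w Hw). replace (d * (w - z))%C with ((w - z) * d)%C in E by ring.
    exact E.
Qed.

(* [C_NormedModule] and the module [C_AbsRing] is over itself are distinct instances; the library's product and chain rules use the latter. *)
Lemma is_derive_cderiv_AbsRing (f : C -> C) (z d : C) :
  is_derive (K := C_AbsRing) (V := AbsRing_NormedModule C_AbsRing) f z d <-> cderiv f z d.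
Proof.
  split.
  - intros [_ H] eps Heps.
    destruct (H z (fun P HP => HP) (mkposreal _ Heps)) as [del Hdel].
    exists del. split; [apply cond_pos|]. intros w Hw.
    replace (d * (w - z))%C with ((w - z) * d)%C by ring.
    exact (Hdel w Hw).
  - intros H. split; [apply (is_linear_scal_l (K := C_AbsRing) (V := AbsRing_NormedModule C_AbsRing))|].
    intros x Hx eps.
    apply (is_filter_lim_locally_unique (K := C_AbsRing) (V := AbsRing_NormedModule C_AbsRing)) in Hx.
    rewrite <- Hx in *. destruct (H eps (cond_pos eps)) as [del [Hd Hdel]].
    exists (mkposreal _ Hd). intros w Hw.
    assert (E := Hdel w Hw). replace (d * (w - z))%C with ((w - z) * d)%C in E by ring.
    exact E.
Qed.

Lemma cderiv_unique (f : C -> C) (z d e : C) : cderiv f z d -> cderiv f z e -> d = e.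
Proof.
  rewrite <- !is_derive_cderiv. intros H1 H2.
  rewrite <- (is_C_derive_unique _ _ _ H1). apply is_C_derive_unique, H2.
Qed.

Lemma cderiv_mult (f g : C -> C) (z df dg : C) :
  cderiv f z df -> cderiv g z dg ->
  cderiv (fun w => f w * g w)%C z (df * g z + f z * dg)%C.
Proof.
  rewrite <- !is_derive_cderiv_AbsRing. intros H1 H2.
  apply (is_derive_mult (K := C_AbsRing) f g z df dg H1 H2). intros; apply Cmult_comm.
Qed.

Lemma cderiv_comp (f g : C -> C) (z df dg : C) :
  cderiv f (g z) df -> cderiv g z dg -> cderiv (fun w => f (g w)) z (dg * df)%C.
Proof.
  rewrite <- !is_derive_cderiv_AbsRing. intros H1 H2.
  exact (is_derive_comp (K := C_AbsRing) (V := AbsRing_NormedModule C_AbsRing) f g z df dg H1 H2).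
Qed.

(** * Power series on the unit disk *)

Lemma Cmod_le_fst_snd (z : C) : Cmod z <= Rabs (fst z) + Rabs (snd z).
Proof.
  assert (E : z = ((fst z : C) + Ci * (snd z : C))%C).
  { destruct z as [x y]. unfold Ci, RtoC, Cplus, Cmult; simpl. f_equal; ring. }
  rewrite E at 1. eapply Rle_trans; [apply Cmod_triangle|].
  rewrite Cmod_mult, Cmod_Ci, !Cmod_R. lra.
Qed.

Lemma fst_le_Cmod (z : C) : Rabs (fst z) <= Cmod z.
Proof. eapply Rle_trans; [apply Rmax_l|apply Rmax_Cmod]. Qed.

Lemma snd_le_Cmod (z : C) : Rabs (snd z) <= Cmod z.
Proof. eapply Rle_trans; [apply Rmax_r|apply Rmax_Cmod]. Qed.

Lemma fst_csum (a : nat -> C) (n : nat) : fst (csum a n) = rsum (fun k => fst (a k)) n.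
Proof. induction n as [|n IH]; simpl; [reflexivity|]. now rewrite IH. Qed.

Lemma snd_csum (a : nat -> C) (n : nat) : snd (csum a n) = rsum (fun k => snd (a k)) n.
Proof. induction n as [|n IH]; simpl; [reflexivity|]. now rewrite IH. Qed.

Lemma cser_fst_snd (a : nat -> C) (l : C) :
  cser a l <-> is_series (fun n => fst (a n)) (fst l) /\ is_series (fun n => snd (a n)) (snd l).
Proof.
  rewrite !is_series_rsum. split.
  - intros H; split; intros eps Heps; destruct (H eps Heps) as [N HN]; exists N; intros n Hn;
      specialize (HN n Hn); [rewrite <- fst_csum|rewrite <- snd_csum];
      eapply Rle_lt_trans; [|exact HN| |exact HN].
    + apply (fst_le_Cmod (csum a n - l)).
    + apply (snd_le_Cmod (csum a n - l)).
  - intros [H1 H2] eps Heps.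
    destruct (H1 (eps / 2)) as [N1 HN1]; [lra|]. destruct (H2 (eps / 2)) as [N2 HN2]; [lra|].
    exists (max N1 N2). intros n Hn.
    specialize (HN1 n ltac:(lia)). specialize (HN2 n ltac:(lia)).
    rewrite <- fst_csum in HN1. rewrite <- snd_csum in HN2.
    eapply Rle_lt_trans; [apply Cmod_le_fst_snd|].
    change (fst (csum a n - l)%C) with (fst (csum a n) - fst l).
    change (snd (csum a n - l)%C) with (snd (csum a n) - snd l). lra.
Qed.

Lemma cser_exists (a : nat -> C) (b : nat -> R) :
  (forall n, Cmod (a n) <= b n) -> ex_series b -> exists l, cser a l.
Proof.
  intros H Hb.
  destruct (ex_series_le (K := C_AbsRing) (V := C_CompleteNormedModule) a b H Hb) as [l Hl].
  exists l. apply is_series_cser, Hl.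
Qed.

(** The bound sees the terms only through the majorant [b], so for a power series one [N] serves all
    points of a circle at once; [parseval_le] depends on this. *)
Lemma cser_tail_le (a : nat -> C) (b : nat -> R) (l : C) (B : R) (N : nat) :
  (forall n, Cmod (a n) <= b n) -> cser a l -> is_series b B ->
  Cmod (l - csum a N) <= B - rsum b N.
Proof.
  intros H Ha Hb. apply le_epsilon. intros eps Heps.
  rewrite is_series_rsum in Hb.
  destruct (Ha (eps / 2)) as [N1 HN1]; [lra|]. destruct (Hb (eps / 2)) as [N2 HN2]; [lra|].
  set (M := max N (max N1 N2)).
  specialize (HN1 M ltac:(lia)). specialize (HN2 M ltac:(lia)).
  assert (T : Cmod (csum a M - csum a N) <= rsum b M - rsum b N).
  { assert (HM : (N <= M)%nat) by lia. clear -H HM. induction HM as [|m Hm IH].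
    - replace (csum a N - csum a N)%C with (RtoC 0) by ring. rewrite Cmod_0. lra.
    - simpl. replace (csum a m + a m - csum a N)%C with ((csum a m - csum a N) + a m)%C by ring.
      eapply Rle_trans; [apply Cmod_triangle|]. specialize (H m). lra. }
  assert (S := Cmod_triangle_sub l (csum a M) (csum a N)).
  rewrite Cmod_minus_sym in HN1. destruct (Rabs_def2 _ _ HN2). lra.
Qed.

Lemma cser_le (a : nat -> C) (b : nat -> R) (l : C) (B : R) :
  (forall n, Cmod (a n) <= b n) -> cser a l -> is_series b B -> Cmod l <= B.
Proof.
  intros H Ha Hb. assert (T := cser_tail_le a b l B 0 H Ha Hb). simpl in T.
  replace (l - 0)%C with l in T by ring. lra.
Qed.

Lemma cser_ext (a b : nat -> C) (l : C) : (forall n, a n = b n) -> cser a l -> cser b l.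
Proof.
  intros E H eps Heps. destruct (H eps Heps) as [N HN]. exists N. intros n Hn.
  rewrite <- (csum_ext a b); auto.
Qed.

Lemma cser_plus (a b : nat -> C) (l m : C) :
  cser a l -> cser b m -> cser (fun n => a n + b n)%C (l + m)%C.
Proof.
  rewrite !cser_fst_snd. intros [H1 H2] [H3 H4].
  split; [exact (is_series_plus _ _ _ _ H1 H3)|exact (is_series_plus _ _ _ _ H2 H4)].
Qed.

Lemma cser_scal (x : C) (a : nat -> C) (l : C) :
  cser a l -> cser (fun n => x * a n)%C (x * l)%C.
Proof.
  rewrite <- !is_series_cser. intros H.
  exact (is_series_scal (K := C_AbsRing) (V := C_NormedModule) x a l H).
Qed.

Lemma cser_shift (a : nat -> C) (l : C) :
  cser (fun n => a (S n)) l -> cser a (a O + l)%C.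
Proof.
  intros H eps Heps. destruct (H eps Heps) as [N HN]. exists (S N). intros [|n] Hn; [lia|].
  rewrite csum_first. replace (a O + csum (fun k => a (S k)) n - (a O + l))%C
    with (csum (fun k => a (S k)) n - l)%C by ring.
  apply HN. lia.
Qed.

Lemma cser_terms_bounded (a : nat -> C) (l : C) :
  cser a l -> exists M, 0 <= M /\ forall n, Cmod (a n) <= M.
Proof.
  intros H. destruct (H 1) as [N HN]; [lra|].
  exists (rsum (fun k => Cmod (a k)) N + 2).
  assert (P : 0 <= rsum (fun k => Cmod (a k)) N).
  { change 0 with (rsum (fun k => Cmod (a k)) 0). apply rsum_incr; [intros; apply Cmod_ge_0|lia]. }
  split; [lra|]. intros n. destruct (Nat.le_gt_cases N n) as [Hn|Hn].
  - assert (A := HN n Hn). assert (B := HN (S n) ltac:(lia)). simpl in B.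
    rewrite Cmod_minus_sym in A.
    assert (T := Cmod_triangle (csum a n + a n - l) (l - csum a n)).
    replace (csum a n + a n - l + (l - csum a n))%C with (a n) in T by ring. lra.
  - assert (Q : rsum (fun k => Cmod (a k)) (S n) <= rsum (fun k => Cmod (a k)) N)
      by (apply rsum_incr; [intros; apply Cmod_ge_0|lia]).
    simpl in Q. assert (0 <= rsum (fun k => Cmod (a k)) n).
    { change 0 with (rsum (fun k => Cmod (a k)) 0). apply rsum_incr; [intros; apply Cmod_ge_0|lia]. }
    lra.
Qed.

Definition summable_on_D (a : nat -> C) : Prop :=
  forall r, 0 <= r < 1 -> ex_series (fun n => Cmod (a n) * r ^ n).

Lemma coef_geometric_bound (a : nat -> C) (f : C -> C) (r : R) :
  has_pseries a f -> 0 < r < 1 -> exists M, 0 <= M /\ forall n, Cmod (a n) * r ^ n <= M.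
Proof.
  intros H Hr.
  assert (Hz : inD (RtoC r)) by (unfold inD; rewrite Cmod_R, Rabs_pos_eq; lra).
  destruct (cser_terms_bounded _ _ (H _ Hz)) as [M [HM HB]].
  exists M. split; [exact HM|]. intros n. specialize (HB n).
  rewrite Cmod_mult, Cmod_pow, Cmod_R, Rabs_pos_eq in HB by lra. exact HB.
Qed.

Lemma has_pseries_summable (a : nat -> C) (f : C -> C) : has_pseries a f -> summable_on_D a.
Proof.
  intros H r Hr. set (s := (1 + r) / 2).
  assert (Hs : 0 < s < 1) by (unfold s; lra).
  destruct (coef_geometric_bound a f s H Hs) as [M [HM HB]].
  apply (ex_series_le (K := R_AbsRing) (V := R_CompleteNormedModule) _
    (fun n => M * (r / s) ^ n)).
  - intros n. change (Rabs (Cmod (a n) * r ^ n) <= M * (r / s) ^ n).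
    assert (0 <= Cmod (a n) * r ^ n) by (apply Rmult_le_pos; [apply Cmod_ge_0|apply pow_le; lra]).
    rewrite Rabs_pos_eq by lra.
    replace (r ^ n) with (s ^ n * (r / s) ^ n)
      by (rewrite <- Rpow_mult_distr; f_equal; field; lra).
    rewrite <- Rmult_assoc. apply Rmult_le_compat_r; [|apply HB].
    apply pow_le. apply Rdiv_le_0_compat; lra.
  - apply (ex_series_scal (K := R_AbsRing) (V := R_NormedModule)).
    exists (/ (1 - r / s)). apply is_series_geom.
    assert (r < s) by (unfold s; lra).
    rewrite Rabs_pos_eq by (apply Rdiv_le_0_compat; lra).
    apply Rmult_lt_reg_r with s; [lra|]. field_simplify; lra.
Qed.

Lemma Cmod_pow_le (z : C) (r : R) (n : nat) : Cmod z <= r -> Cmod (z ^ n) <= r ^ n.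
Proof. intros H. rewrite Cmod_pow. apply pow_incr. split; [apply Cmod_ge_0|exact H]. Qed.

Lemma Cmod_term_le (a : nat -> C) (z : C) (r : R) :
  Cmod z <= r -> forall n, Cmod (a n * z ^ n) <= Cmod (a n) * r ^ n.
Proof.
  intros H n. rewrite Cmod_mult. apply Rmult_le_compat_l; [apply Cmod_ge_0|now apply Cmod_pow_le].
Qed.

(** [Series] is total, so [psum] needs no convergence proof as an argument; its value is meaningful
    on the disk once [summable_on_D a] is known. *)
Definition psum (a : nat -> C) (z : C) : C :=
  (Series (fun n => fst (a n * z ^ n)%C), Series (fun n => snd (a n * z ^ n)%C)).

Lemma psum_correct (a : nat -> C) : summable_on_D a -> has_pseries a (psum a).
Proof.
  intros H z Hz.
  destruct (cser_exists (fun n => a n * z ^ n)%C _ (Cmod_term_le a z _ (Rle_refl _))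
    (H (Cmod z) (conj (Cmod_ge_0 z) Hz))) as [l Hl].
  replace (psum a z) with l; [exact Hl|].
  apply cser_fst_snd in Hl. destruct Hl as [H1 H2].
  unfold psum. rewrite (is_series_unique _ _ H1), (is_series_unique _ _ H2). now destruct l.
Qed.

Lemma has_pseries_plus (a b : nat -> C) (f g : C -> C) :
  has_pseries a f -> has_pseries b g ->
  has_pseries (fun n => a n + b n)%C (fun z => f z + g z)%C.
Proof.
  intros Ha Hb z Hz. eapply cser_ext; [|apply cser_plus; [apply Ha, Hz|apply Hb, Hz]].
  intros n; simpl; ring.
Qed.

Lemma has_pseries_scal (x : C) (a : nat -> C) (f : C -> C) :
  has_pseries a f -> has_pseries (fun n => x * a n)%C (fun z => x * f z)%C.
Proof.
  intros Ha z Hz. eapply cser_ext; [|apply (cser_scal x), Ha, Hz]. intros n; simpl; ring.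
Qed.

Lemma has_pseries_ext (a b : nat -> C) (f g : C -> C) :
  (forall n, a n = b n) -> (forall z, inD z -> f z = g z) ->
  has_pseries a f -> has_pseries b g.
Proof.
  intros E1 E2 H z Hz. rewrite <- E2 by exact Hz.
  eapply cser_ext; [|apply H, Hz]. intros n; simpl; now rewrite E1.
Qed.

Definition shift1 (a : nat -> C) (n : nat) : C :=
  match n with O => 0%C | S m => a m end.

Lemma has_pseries_shift1 (a : nat -> C) (f : C -> C) :
  has_pseries a f -> has_pseries (shift1 a) (fun z => z * f z)%C.
Proof.
  intros H z Hz. assert (T := cser_scal z _ _ (H z Hz)).
  replace (z * f z)%C with (shift1 a 0 * z ^ 0 + z * f z)%C by (simpl; ring).
  apply (cser_shift (fun n => shift1 a n * z ^ n)%C).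
  eapply cser_ext; [|exact T]. intros n; simpl; ring.
Qed.

Lemma has_pseries_at_0 (a : nat -> C) (f : C -> C) : has_pseries a f -> f 0%C = a O.
Proof.
  intros H. assert (H0 : inD 0%C) by (unfold inD; rewrite Cmod_0; lra).
  apply (cser_unique _ _ _ (H _ H0)). intros eps Heps. exists 1%nat. intros [|n] Hn; [lia|].
  rewrite csum_first.
  rewrite (csum_ext _ (fun _ => 0%C)) by (intros; simpl; ring).
  rewrite csum_zero. replace (a O * 0 ^ 0 + 0 - a O)%C with (RtoC 0) by (simpl; ring).
  rewrite Cmod_0; lra.
Qed.

Definition conv (a b : nat -> C) (n : nat) : C := csum (fun k => a k * b (n - k)%nat)%C (S n).

(* The real and imaginary parts of a product of complex series are sums of products of absolutely convergent real ones. *)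
Lemma cser_conv (a b : nat -> C) (l m : C) :
  cser a l -> cser b m -> ex_series (fun n => Cmod (a n)) -> ex_series (fun n => Cmod (b n)) ->
  cser (conv a b) (l * m)%C.
Proof.
  rewrite !cser_fst_snd. intros [H1 H2] [H3 H4] Ea Eb.
  assert (A : forall (p : C -> R) (u : nat -> C), (forall z, Rabs (p z) <= Cmod z) ->
    ex_series (fun n => Cmod (u n)) -> ex_series (fun n => Rabs (p (u n)))).
  { intros p u Hp. apply (ex_series_le (K := R_AbsRing) (V := R_CompleteNormedModule)).
    intros n. change (Rabs (Rabs (p (u n))) <= Cmod (u n)). rewrite Rabs_Rabsolu. apply Hp. }
  assert (A1 := A fst a fst_le_Cmod Ea). assert (A2 := A snd a snd_le_Cmod Ea).
  assert (B1 := A fst b fst_le_Cmod Eb). assert (B2 := A snd b snd_le_Cmod Eb).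
  assert (S11 := is_series_mult _ _ _ _ H1 H3 A1 B1).
  assert (S12 := is_series_mult _ _ _ _ H1 H4 A1 B2).
  assert (S21 := is_series_mult _ _ _ _ H2 H3 A2 B1).
  assert (S22 := is_series_mult _ _ _ _ H2 H4 A2 B2).
  assert (F : forall u n, sum_f_R0 u n = rsum u (S n)).
  { intros u n. now rewrite rsum_sum_n, sum_n_Reals. }
  assert (G : forall u v n, rsum (fun k => u k + v k) n = rsum u n + rsum v n).
  { intros u v n. induction n as [|n IH]; simpl; [ring|]. rewrite IH. ring. }
  assert (G' : forall u v n, rsum (fun k => u k - v k) n = rsum u n - rsum v n).
  { intros u v n. induction n as [|n IH]; simpl; [ring|]. rewrite IH. ring. }
  split.
  - apply (is_series_ext (K := R_AbsRing) (V := R_NormedModule)) with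
      (2 := is_series_minus _ _ _ _ S11 S22).
    intros n. unfold conv. rewrite fst_csum, !F.
    change (rsum (fun k => fst (a k) * fst (b (n - k)%nat)) (S n) -
      rsum (fun k => snd (a k) * snd (b (n - k)%nat)) (S n) =
      rsum (fun k => fst (a k * b (n - k)%nat)%C) (S n)).
    rewrite <- G'. reflexivity.
  - apply (is_series_ext (K := R_AbsRing) (V := R_NormedModule)) with
      (2 := is_series_plus _ _ _ _ S12 S21).
    intros n. unfold conv. rewrite snd_csum, !F.
    change (rsum (fun k => fst (a k) * snd (b (n - k)%nat)) (S n) +
      rsum (fun k => snd (a k) * fst (b (n - k)%nat)) (S n) =
      rsum (fun k => snd (a k * b (n - k)%nat)%C) (S n)).
    rewrite <- G. reflexivity.
Qed.

Lemma has_pseries_mult (a b : nat -> C) (f g : C -> C) :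
  has_pseries a f -> has_pseries b g -> has_pseries (conv a b) (fun z => f z * g z)%C.
Proof.
  intros Ha Hb z Hz.
  assert (R1 : 0 <= Cmod z < 1) by (split; [apply Cmod_ge_0|exact Hz]).
  assert (E : forall u h, has_pseries u h -> ex_series (fun n => Cmod (u n * z ^ n)%C)).
  { intros u h Hu. eapply ex_series_ext; [|apply (has_pseries_summable _ _ Hu _ R1)].
    intros n; simpl. now rewrite Cmod_mult, Cmod_pow. }
  eapply cser_ext; [|exact (cser_conv _ _ _ _ (Ha z Hz) (Hb z Hz) (E _ _ Ha) (E _ _ Hb))].
  intros n. unfold conv. rewrite Cmult_comm, <- csum_scal. apply csum_ext. intros k Hk.
  replace n with (k + (n - k))%nat at 3 by lia. rewrite Cpow_add_r. ring.
Qed.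

(** * Term-by-term differentiation and uniqueness of coefficients *)

Definition dcoef (a : nat -> C) (n : nat) : C := (RtoC (INR (S n)) * a (S n))%C.

Lemma INR_pow_pred_S (x : R) (n : nat) :
  INR (S n) * x ^ pred (S n) = x * (INR n * x ^ pred n) + x ^ n.
Proof.
  destruct n as [|n]; [simpl; ring|]. rewrite (S_INR (S n)). simpl pred.
  change (x ^ S n) with (x * x ^ n). ring.
Qed.

Lemma INR_Cpow_pred_S (z : C) (n : nat) :
  (RtoC (INR (S n)) * z ^ pred (S n) = z * (RtoC (INR n) * z ^ pred n) + z ^ n)%C.
Proof.
  destruct n as [|n]; [simpl; ring|]. rewrite (S_INR (S n)), RtoC_plus. simpl pred.
  change (z ^ S n)%C with (z * z ^ n)%C. ring.
Qed.

Lemma pow_taylor1_le (r del : R) (n : nat) :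
  0 <= r -> 0 <= del -> r ^ n + INR n * r ^ pred n * del <= (r + del) ^ n.
Proof.
  intros Hr Hd. induction n as [|n IH]; [simpl; lra|].
  rewrite INR_pow_pred_S. change ((r + del) ^ S n) with ((r + del) * (r + del) ^ n).
  change (r ^ S n) with (r * r ^ n).
  assert (0 <= INR n * r ^ pred n) by (apply Rmult_le_pos; [apply pos_INR|apply pow_le, Hr]).
  assert (0 <= (r + del) * ((r + del) ^ n - (r ^ n + INR n * r ^ pred n * del)))
    by (apply Rmult_le_pos; lra).
  assert (0 <= INR n * r ^ pred n * (del * del)) by (apply Rmult_le_pos; [assumption|nra]).
  nra.
Qed.

(* The same recursion bounds the complex Taylor remainder of z^n by the real one, which avoids any estimate of n^2 r^n. *)
Lemma Cpow_taylor1_le (z h : C) (r del : R) (n : nat) :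
  Cmod z <= r -> Cmod h <= del -> 0 < del ->
  Cmod ((z + h) ^ n - z ^ n - RtoC (INR n) * z ^ pred n * h) * (del * del)
    <= Cmod h * Cmod h * ((r + del) ^ n - r ^ n - INR n * r ^ pred n * del).
Proof.
  intros Hz Hh Hd. assert (Hr : 0 <= r) by (assert (T := Cmod_ge_0 z); lra).
  assert (Hh0 := Cmod_ge_0 h).
  induction n as [|n IH].
  - simpl. replace (1 - 1 - 0 * 1 * h)%C with (RtoC 0) by ring. rewrite Cmod_0. lra.
  - rewrite INR_pow_pred_S, INR_Cpow_pred_S.
    set (T := (RtoC (INR n) * z ^ pred n)%C) in *. set (t := INR n * r ^ pred n) in *.
    set (Q := ((z + h) ^ n - z ^ n - T * h)%C) in *.
    replace ((z + h) ^ S n - z ^ S n - (z * T + z ^ n) * h)%C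
      with ((z + h) * Q + T * (h * h))%C by (unfold Q; simpl; ring).
    assert (HT : Cmod T <= t).
    { unfold T, t. rewrite Cmod_mult, Cmod_R, Rabs_pos_eq by apply pos_INR.
      apply Rmult_le_compat_l; [apply pos_INR|apply Cmod_pow_le, Hz]. }
    assert (HQ := Cmod_ge_0 Q). assert (HT0 := Cmod_ge_0 T).
    assert (Hzh : Cmod (z + h) <= r + del) by (eapply Rle_trans; [apply Cmod_triangle|lra]).
    assert (B1 : Cmod ((z + h) * Q) <= (r + del) * Cmod Q)
      by (rewrite Cmod_mult; apply Rmult_le_compat_r; lra).
    assert (B2 : Cmod (T * (h * h)) <= t * (Cmod h * Cmod h)).
    { rewrite !Cmod_mult. apply Rmult_le_compat_r; [nra|lra]. }
    assert (B3 := Cmod_triangle ((z + h) * Q) (T * (h * h))).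
    apply Rle_trans with (((r + del) * Cmod Q + t * (Cmod h * Cmod h)) * (del * del)).
    { apply Rmult_le_compat_r; [nra|lra]. }
    apply Rle_trans with ((r + del) * (Cmod Q * (del * del)) + t * (Cmod h * Cmod h) * (del * del)); [right; ring|].
    change ((r + del) ^ S n) with ((r + del) * (r + del) ^ n). change (r ^ S n) with (r * r ^ n).
    apply Rle_trans with ((r + del) * (Cmod h * Cmod h * ((r + del) ^ n - r ^ n - t * del)) + t * (Cmod h * Cmod h) * (del * del)); [|right; ring].
    apply Rplus_le_compat_r, Rmult_le_compat_l; [lra|exact IH].
Qed.

(** By [pow_taylor1_le], n r^(n-1) del <= (r + del)^n, so the derived series at radius r is
    dominated by the original one at the larger radius r + del < 1. *)
Lemma summable_dcoef (a : nat -> C) : summable_on_D a -> summable_on_D (dcoef a).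
Proof.
  intros H r Hr. set (del := (1 - r) / 2). assert (Hd : 0 < del) by (unfold del; lra).
  assert (E : ex_series (fun n => Cmod (a n) * (r + del) ^ n)) by (apply H; unfold del; lra).
  apply (ex_series_incr_1 (K := R_AbsRing) (V := R_NormedModule)) in E.
  apply (ex_series_scal (K := R_AbsRing) (V := R_NormedModule) (/ del)) in E.
  revert E. apply (ex_series_le (K := R_AbsRing) (V := R_CompleteNormedModule)).
  intros n. change (Rabs (Cmod (dcoef a n) * r ^ n) <= / del * (Cmod (a (S n)) * (r + del) ^ S n)).
  unfold dcoef. rewrite Cmod_mult, Cmod_R, (Rabs_pos_eq (INR _)) by apply pos_INR.
  assert (P := pow_taylor1_le r del (S n) ltac:(lra) ltac:(lra)). simpl pred in P.
  assert (0 <= r ^ S n) by (apply pow_le; lra).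
  assert (Ca := Cmod_ge_0 (a (S n))). assert (I := pos_INR (S n)).
  assert (0 <= r ^ n) by (apply pow_le; lra).
  rewrite Rabs_pos_eq by (repeat apply Rmult_le_pos; lra).
  apply Rmult_le_reg_l with del; [exact Hd|]. rewrite <- !Rmult_assoc, Rinv_r, Rmult_1_l by lra.
  apply Rle_trans with (Cmod (a (S n)) * (INR (S n) * r ^ n * del)); [right; ring|].
  apply Rmult_le_compat_l; lra.
Qed.

(** Summing [Cpow_taylor1_le] against |a_n| bounds the first-order remainder by |h|^2 K / del^2,
    where K is the sum of |a_n| (r + del)^n at a radius still below 1. *)
Lemma has_pseries_cderiv (a : nat -> C) (f : C -> C) (z : C) :
  has_pseries a f -> inD z -> cderiv f z (psum (dcoef a) z).
Proof.
  intros H Hz. assert (Hs := has_pseries_summable a f H).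
  assert (Hd := psum_correct _ (summable_dcoef a Hs) z Hz).
  set (d := psum (dcoef a) z) in *.
  assert (Hd' : cser (fun n => a n * (RtoC (INR n) * z ^ pred n))%C d).
  { replace d with (a O * (RtoC (INR 0) * z ^ pred 0) + d)%C by (simpl; ring).
    apply (cser_shift (fun n => a n * (RtoC (INR n) * z ^ pred n))%C).
    eapply cser_ext; [|exact Hd]. intros n. unfold dcoef. simpl pred. ring. }
  unfold inD in Hz. assert (Hz0 := Cmod_ge_0 z).
  set (r := Cmod z) in *. set (del := (1 - r) / 2). assert (Hdel : 0 < del) by (unfold del; lra).
  assert (Hr : 0 <= r + del < 1) by (unfold del; lra).
  destruct (Hs (r + del) Hr) as [K HK].
  assert (HK0 : 0 <= K).
  { rewrite <- (is_series_unique _ _ HK).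
    rewrite <- (is_series_unique (fun _ : nat => 0) 0).
    - apply Series_le; [|exists K; exact HK]. intros n. split; [lra|].
      apply Rmult_le_pos; [apply Cmod_ge_0|apply pow_le; lra].
    - apply is_series_rsum. intros eps Heps. exists O. intros n _.
      replace (rsum (fun _ => 0) n) with 0 by (induction n as [|n IH]; simpl; lra).
      rewrite Rminus_0_r, Rabs_R0. exact Heps. }
  intros eps Heps. exists (Rmin del (eps * (del * del) / (K + 1))).
  split.
  { apply Rmin_pos; [exact Hdel|]. apply Rdiv_lt_0_compat; [|lra]. apply Rmult_lt_0_compat; nra. }
  intros w Hw. assert (W1 := Rlt_le_trans _ _ _ Hw (Rmin_l _ _)).
  assert (W2 := Rlt_le_trans _ _ _ Hw (Rmin_r _ _)).
  set (h := (w - z)%C) in *. replace w with (z + h)%C by (unfold h; ring).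
  assert (Hw' : inD (z + h)%C).
  { unfold inD. eapply Rle_lt_trans; [apply Cmod_triangle|]. fold r. lra. }
  assert (E : cser (fun n => a n * ((z + h) ^ n - z ^ n - RtoC (INR n) * z ^ pred n * h))%C
    (f (z + h) - f z - d * h)%C).
  { assert (E1 := cser_plus _ _ _ _ (H _ Hw')
      (cser_plus _ _ _ _ (cser_scal (-1)%C _ _ (H z Hz)) (cser_scal (- h)%C _ _ Hd'))).
    replace (f (z + h) - f z - d * h)%C with (f (z + h) + (-1 * f z + - h * d))%C by ring.
    eapply cser_ext; [|exact E1]. intros n; simpl; ring. }
  assert (B : Cmod (f (z + h) - f z - d * h)%C <= Cmod h * Cmod h / (del * del) * K).
  { apply (cser_le _ (fun n => Cmod h * Cmod h / (del * del) * (Cmod (a n) * (r + del) ^ n)) _ _) with (2 := E).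
    - intros n. rewrite Cmod_mult.
      assert (T := Cpow_taylor1_le z h r del n (Rle_refl _) (Rlt_le _ _ W1) Hdel).
      set (q := Cmod ((z + h) ^ n - z ^ n - RtoC (INR n) * z ^ pred n * h)) in *.
      assert (Hh := Cmod_ge_0 h).
      assert (0 <= r ^ n) by (apply pow_le; lra).
      assert (0 <= INR n * r ^ pred n * del)
        by (apply Rmult_le_pos; [apply Rmult_le_pos; [apply pos_INR|apply pow_le; lra]|lra]).
      assert (Q : q <= Cmod h * Cmod h / (del * del) * (r + del) ^ n).
      { apply Rmult_le_reg_r with (del * del); [nra|].
        eapply Rle_trans; [exact T|].
        replace (Cmod h * Cmod h / (del * del) * (r + del) ^ n * (del * del))
          with (Cmod h * Cmod h * (r + del) ^ n) by (field; lra).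
        apply Rmult_le_compat_l; [nra|lra]. }
      eapply Rle_trans; [apply Rmult_le_compat_l; [apply Cmod_ge_0|exact Q]|]. right; ring.
    - exact (is_series_scal (K := R_AbsRing) (V := R_NormedModule) _ _ _ HK). }
  eapply Rle_trans; [exact B|].
  assert (Hh := Cmod_ge_0 h).
  replace (Cmod h * Cmod h / (del * del) * K) with (Cmod h * K / (del * del) * Cmod h) by (field; lra).
  apply Rmult_le_compat_r; [exact Hh|].
  apply Rmult_le_reg_r with (del * del); [nra|].
  replace (Cmod h * K / (del * del) * (del * del)) with (Cmod h * K) by (field; lra).
  apply Rmult_lt_compat_r with (r := K + 1) in W2; [|lra].
  replace (eps * (del * del) / (K + 1) * (K + 1)) with (eps * (del * del)) in W2 by (field; lra).
  nra.
Qed.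

(** It suffices to treat the zero function. Its series has constant term 0, and its derived series
    again represents zero, so induction on the index reaches every coefficient. *)
Lemma has_pseries_unique (a b : nat -> C) (f : C -> C) :
  has_pseries a f -> has_pseries b f -> forall n, a n = b n.
Proof.
  assert (Z : forall n a, has_pseries a (fun _ => 0%C) -> a n = 0%C).
  { induction n as [|n IH]; intros u Hu.
    - symmetry. exact (has_pseries_at_0 u _ Hu).
    - assert (D : has_pseries (dcoef u) (fun _ => 0%C)).
      { apply (has_pseries_ext (dcoef u) _ (psum (dcoef u)) _ (fun n => eq_refl)).
        - intros z Hz. apply (cderiv_unique (fun _ => 0%C) z).
          + exact (has_pseries_cderiv u _ z Hu Hz).
          + intros eps Heps. exists 1. split; [lra|]. intros w _.
            replace (0 - 0 - 0 * (w - z))%C with (RtoC 0) by ring. rewrite Cmod_0.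
            apply Rmult_le_pos; [lra|apply Cmod_ge_0].
        - apply psum_correct, summable_dcoef, (has_pseries_summable _ _ Hu). }
      apply IH in D. unfold dcoef in D.
      assert (N : RtoC (INR (S n)) <> 0%C).
      { intros E. apply RtoC_inj in E. revert E. apply not_0_INR. lia. }
      replace (u (S n)) with (/ RtoC (INR (S n)) * (RtoC (INR (S n)) * u (S n)))%C
        by (field; exact N).
      rewrite D. ring. }
  intros Ha Hb n.
  assert (T : (a n + -1 * b n)%C = 0%C).
  { apply (Z n (fun n => a n + -1 * b n)%C).
    apply (has_pseries_ext _ _ _ _ (fun n => eq_refl)) with
      (2 := has_pseries_plus _ _ _ _ Ha (has_pseries_scal (-1)%C _ _ Hb)).
    intros z _. simpl. ring. }
  replace (a n) with ((a n + -1 * b n) + b n)%C by ring. rewrite T. ring.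
Qed.

(** The mean value theorem is real, so it is applied to a coordinate of f along the segment from 0
    to z. The coordinate is an abstract [p], additive and bounded by [Cmod], which covers real and
    imaginary parts together. *)
Lemma cderiv_0_constant (f : C -> C) :
  (forall z, inD z -> cderiv f z 0%C) -> forall z, inD z -> f z = f 0%C.
Proof.
  intros H z Hz.
  assert (P : forall p : C -> R, (forall u v, p (u - v)%C = p u - p v) ->
    (forall u, Rabs (p u) <= Cmod u) -> p (f z) = p (f 0%C)).
  { intros p Hp Hle. set (g := fun t : R => p (f (RtoC t * z)%C)).
    assert (Dg : forall t, 0 <= t <= 1 -> is_derive g t 0).
    { intros t Ht. apply is_derive_Reals. intros eps Heps.
      assert (Ht' : inD (RtoC t * z)%C).
      { unfold inD in *. rewrite Cmod_mult, Cmod_R, Rabs_pos_eq by lra.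
        assert (Z := Cmod_ge_0 z). nra. }
      destruct (H _ Ht' (eps / 2)) as [del [Hdel Hf]]; [lra|].
      exists (mkposreal _ Hdel). intros h Hh0 Hh. simpl in Hh.
      assert (Hm : Cmod (RtoC (t + h) * z - RtoC t * z) <= Rabs h).
      { replace (RtoC (t + h) * z - RtoC t * z)%C with (RtoC h * z)%C
          by (rewrite RtoC_plus; ring).
        rewrite Cmod_mult, Cmod_R. unfold inD in Hz. assert (A := Rabs_pos h). nra. }
      specialize (Hf (RtoC (t + h) * z)%C ltac:(lra)).
      replace (f (RtoC (t + h) * z) - f (RtoC t * z) - 0 * (RtoC (t + h) * z - RtoC t * z))%C
        with (f (RtoC (t + h) * z) - f (RtoC t * z))%C in Hf by ring.
      unfold g. rewrite <- Hp, Rminus_0_r.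
      assert (Ha : 0 < Rabs h) by (apply Rabs_pos_lt, Hh0).
      unfold Rdiv. rewrite Rabs_mult, Rabs_inv.
      apply Rmult_lt_reg_r with (Rabs h); [exact Ha|].
      rewrite Rmult_assoc, Rinv_l, Rmult_1_r by lra.
      eapply Rle_lt_trans; [apply Hle|]. nra. }
    assert (E : g 1 = g 0).
    { destruct (MVT_gen g 0 1 (fun _ => 0)) as [c [_ Hc]].
      - intros x. rewrite Rmin_left, Rmax_right by lra. intros Hx. apply Dg; lra.
      - intros x. rewrite Rmin_left, Rmax_right by lra. intros Hx.
        apply continuity_pt_filterlim. apply (ex_derive_continuous (K := R_AbsRing) (V := R_NormedModule)).
        exists 0. apply Dg; lra.
      - lra. }
    unfold g in E. replace (RtoC 1 * z)%C with z in E by ring.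
    replace (RtoC 0 * z)%C with (RtoC 0) in E by ring. exact E. }
  apply injective_projections; [apply (P fst)|apply (P snd)];
    try (intros; reflexivity); [apply fst_le_Cmod|apply snd_le_Cmod].
Qed.

(** * The equation h' = q h *)

(* [ode_approx q n k] is the k-th coefficient of the solution of h' = q h, h(0) = 1, correct for k <= n. *)
Fixpoint ode_approx (q : nat -> C) (n k : nat) : C :=
  match n with
  | O => 1%C
  | S m => if Nat.leb k m then ode_approx q m k
           else (/ RtoC (INR (S m)) * conv q (ode_approx q m) m)%C
  end.

Definition ode_coef (q : nat -> C) (n : nat) : C := ode_approx q n n.

Lemma ode_approx_stable (q : nat -> C) (m k : nat) :
  (k <= m)%nat -> ode_approx q m k = ode_coef q k.
Proof.
  induction 1 as [|m Hm IH]; [reflexivity|]. simpl.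
  now rewrite (proj2 (Nat.leb_le k m) Hm).
Qed.

Lemma ode_coef_S (q : nat -> C) (n : nat) :
  (RtoC (INR (S n)) * ode_coef q (S n) = conv q (ode_coef q) n)%C.
Proof.
  change (ode_coef q (S n)) with (if Nat.leb (S n) n then ode_approx q n (S n)
    else (/ RtoC (INR (S n)) * conv q (ode_approx q n) n)%C).
  rewrite (proj2 (Nat.leb_gt (S n) n)) by lia.
  replace (conv q (ode_approx q n) n) with (conv q (ode_coef q) n).
  - field.
    intros E. apply RtoC_inj in E. revert E. apply not_0_INR. lia.
  - unfold conv. apply csum_ext. intros k Hk. now rewrite ode_approx_stable by lia.
Qed.

(** The convolution of [h] with the powers of x, in recursive form. It replaces the recursion of
    [ode_coef], which involves all earlier coefficients, by a first-order one. *)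
Fixpoint geom_conv (x : R) (h : nat -> R) (n : nat) : R :=
  match n with O => h O | S m => h (S m) + x * geom_conv x h m end.

Lemma geom_conv_rsum (x : R) (h : nat -> R) (n : nat) :
  rsum (fun k => x ^ k * h (n - k)%nat) (S n) = geom_conv x h n.
Proof.
  induction n as [|n IH]; [simpl; ring|].
  rewrite rsum_first. simpl geom_conv. rewrite <- IH, <- rsum_scal.
  rewrite Nat.sub_0_r, pow_O, Rmult_1_l. f_equal.
  assert (E : forall u v N, (forall k, (k < N)%nat -> u k = v k) -> rsum u N = rsum v N).
  { intros u v N HN. apply Rle_antisym; apply rsum_le; intros k Hk; right; rewrite HN; auto. }
  apply E. intros k Hk. simpl. ring.
Qed.

(** If |q_n| <= M x^n and g_n is the convolution of |h_k| with x^k, then (n+1) |h_(n+1)| <= M g_n,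
    so g_(n+1) = |h_(n+1)| + x g_n <= (M/(n+1) + x) g_n. The majorant is the resulting product. Its
    successive ratios tend to x, which gives the radius of convergence. *)
Fixpoint ode_majorant (M x : R) (n : nat) : R :=
  match n with O => 1 | S m => (M / INR (S m) + x) * ode_majorant M x m end.

Lemma ode_majorant_pos (M x : R) (n : nat) : 0 <= M -> 0 < x -> 0 < ode_majorant M x n.
Proof.
  intros HM Hx. induction n as [|n IH]; [simpl; lra|].
  change (0 < (M / INR (S n) + x) * ode_majorant M x n).
  apply Rmult_lt_0_compat; [|exact IH].
  assert (0 <= M / INR (S n)); [|lra]. apply Rdiv_le_0_compat; [exact HM|apply lt_0_INR; lia].
Qed.

Lemma ode_coef_le_majorant (q : nat -> C) (M x : R) :
  0 <= M -> 0 < x -> (forall n, Cmod (q n) <= M * x ^ n) ->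
  forall n, Cmod (ode_coef q n) <= ode_majorant M x n.
Proof.
  intros HM Hx Hq. set (h := fun n => Cmod (ode_coef q n)).
  assert (G : forall n, h n <= geom_conv x h n /\ 0 <= geom_conv x h n).
  { induction n as [|n [IH1 IH2]]; simpl; unfold h at 1; assert (T := Cmod_ge_0 (ode_coef q 0)).
    - fold (h O). unfold h. lra.
    - assert (T1 := Cmod_ge_0 (ode_coef q (S n))). fold (h (S n)) in *. nra. }
  assert (B : forall n, geom_conv x h n <= ode_majorant M x n).
  { induction n as [|n IH].
    - simpl. unfold h, ode_coef. simpl. rewrite Cmod_1. lra.
    - change (h (S n) + x * geom_conv x h n <= (M / INR (S n) + x) * ode_majorant M x n).
      assert (HS : INR (S n) * h (S n) <= M * geom_conv x h n).
      { unfold h at 1. assert (E := f_equal Cmod (ode_coef_S q n)).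
        rewrite Cmod_mult, Cmod_R, Rabs_pos_eq in E by apply pos_INR. rewrite E.
        rewrite <- geom_conv_rsum, <- rsum_scal. unfold conv. apply Cmod_csum_le.
        intros k Hk. rewrite Cmod_mult, <- Rmult_assoc. apply Rmult_le_compat_r; [apply Cmod_ge_0|apply Hq]. }
      assert (I : 0 < INR (S n)) by (apply lt_0_INR; lia).
      assert (HS' : h (S n) <= M / INR (S n) * geom_conv x h n).
      { apply Rmult_le_reg_l with (INR (S n)); [exact I|].
        replace (INR (S n) * (M / INR (S n) * geom_conv x h n)) with (M * geom_conv x h n) by (field; lra).
        exact HS. }
      assert (0 <= M / INR (S n)) by (apply Rdiv_le_0_compat; lra).
      apply Rle_trans with ((M / INR (S n) + x) * geom_conv x h n); [lra|].
      apply Rmult_le_compat_l; lra. }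
  intros n. eapply Rle_trans; [apply G|apply B].
Qed.

Lemma ode_coef_summable (q : nat -> C) (Q : C -> C) : has_pseries q Q -> summable_on_D (ode_coef q).
Proof.
  intros H r Hr. set (s := (1 + r) / 2). assert (Hs : 0 < s < 1) by (unfold s; lra).
  destruct (coef_geometric_bound q Q s H Hs) as [M [HM HB]].
  assert (Hx : 0 < / s) by (apply Rinv_0_lt_compat; lra).
  assert (Hq : forall n, Cmod (q n) <= M * (/ s) ^ n).
  { intros n. specialize (HB n). rewrite pow_inv.
    assert (P : 0 < s ^ n) by (apply pow_lt; lra).
    apply Rmult_le_reg_r with (s ^ n); [exact P|]. rewrite Rmult_assoc, Rinv_l by lra. lra. }
  assert (L := ode_coef_le_majorant q M (/ s) HM Hx Hq).
  (* The ratio test requires nonzero terms, and these vanish from index 1 on when r = 0. *)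
  destruct (Req_dec r 0) as [->|Hr0].
  { exists (Cmod (ode_coef q 0)). apply is_series_rsum. intros eps Heps. exists 1%nat.
    intros [|n] Hn; [lia|]. rewrite rsum_first.
    replace (rsum (fun k => Cmod (ode_coef q (S k)) * 0 ^ S k) n) with 0.
    - simpl. replace (_ - _) with 0 by ring. now rewrite Rabs_R0.
    - clear. induction n as [|n IH]; [reflexivity|]. cbn [rsum].
      rewrite <- IH, pow_ne_zero by lia. ring. }
  assert (D : ex_series (fun n => Rabs (ode_majorant M (/ s) n * r ^ n))).
  { assert (Pm := fun n => ode_majorant_pos M (/ s) n HM Hx).
    apply ex_series_DAlembert with (k := (0 + / s) * r).
    - rewrite Rplus_0_l. apply Rmult_lt_reg_l with s; [lra|].
      rewrite <- Rmult_assoc, Rinv_r by lra. unfold s; lra.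
    - intros n. apply Rgt_not_eq. apply Rmult_lt_0_compat; [apply Pm|apply pow_lt; lra].
    - apply is_lim_seq_ext with (fun n => (M * / INR (S n) + / s) * r).
      + intros n. specialize (Pm n). assert (0 < r ^ n) by (apply pow_lt; lra).
        assert (I : 0 < INR (S n)) by (apply lt_0_INR; lia).
        change (ode_majorant M (/ s) (S n)) with ((M / INR (S n) + / s) * ode_majorant M (/ s) n).
        change (r ^ S n) with (r * r ^ n).
        replace ((M / INR (S n) + / s) * ode_majorant M (/ s) n * (r * r ^ n) / (ode_majorant M (/ s) n * r ^ n))
          with ((M / INR (S n) + / s) * r) by (field; repeat split; lra).
        rewrite Rabs_pos_eq; [reflexivity|]. apply Rmult_le_pos; [|lra].
        assert (0 <= M / INR (S n)) by (apply Rdiv_le_0_compat; lra). lra.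
      + apply (is_lim_seq_scal_r _ r (Finite (0 + / s))).
        apply is_lim_seq_plus'; [|apply is_lim_seq_const].
        replace (Finite 0) with (Rbar_mult M 0) by (simpl; f_equal; ring).
        apply is_lim_seq_scal_l.
        apply (is_lim_seq_incr_1 (fun n => / INR n)).
        replace (Finite 0) with (Rbar_inv p_infty) by reflexivity.
        apply is_lim_seq_inv; [apply is_lim_seq_INR|discriminate]. }
  revert D. apply (ex_series_le (K := R_AbsRing) (V := R_CompleteNormedModule)).
  intros n. change (Rabs (Cmod (ode_coef q n) * r ^ n) <= Rabs (ode_majorant M (/ s) n * r ^ n)).
  assert (0 <= r ^ n) by (apply pow_le; lra). assert (C0 := Cmod_ge_0 (ode_coef q n)).
  specialize (L n). rewrite !Rabs_pos_eq; [|apply Rmult_le_pos; lra|apply Rmult_le_pos; lra].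
  apply Rmult_le_compat_r; lra.
Qed.

Lemma ode_solution (q : nat -> C) (Q : C -> C) :
  has_pseries q Q ->
  has_pseries (ode_coef q) (psum (ode_coef q)) /\ psum (ode_coef q) 0%C = 1%C /\
  forall z, inD z -> cderiv (psum (ode_coef q)) z (Q z * psum (ode_coef q) z)%C.
Proof.
  intros H. assert (Hs := ode_coef_summable q Q H). assert (Hp := psum_correct _ Hs).
  split; [exact Hp|split].
  - now rewrite (has_pseries_at_0 _ _ Hp).
  - intros z Hz. replace (Q z * psum (ode_coef q) z)%C with (psum (dcoef (ode_coef q)) z).
    + apply has_pseries_cderiv; assumption.
    + apply (cser_unique (fun n => dcoef (ode_coef q) n * z ^ n)%C).
      * apply psum_correct; [apply summable_dcoef, Hs|exact Hz].
      * eapply cser_ext; [|apply (has_pseries_mult _ _ _ _ H Hp z Hz)].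
        intros n. simpl. unfold dcoef. now rewrite ode_coef_S.
Qed.

(** (f g)' = Q f g - Q f g = 0. This gives both the non-vanishing of solutions and the
    identification of a series solution with an exponential. *)
Lemma ode_inverse (f g : C -> C) (Q : C -> C) :
  f 0%C = 1%C -> g 0%C = 1%C ->
  (forall z, inD z -> cderiv f z (Q z * f z)%C) ->
  (forall z, inD z -> cderiv g z (- Q z * g z)%C) ->
  forall z, inD z -> (f z * g z)%C = 1%C.
Proof.
  intros F0 G0 HF HG z Hz.
  rewrite (cderiv_0_constant (fun w => f w * g w)%C); [now rewrite F0, G0, Cmult_1_r| |exact Hz].
  intros w Hw. replace (RtoC 0) with (Q w * f w * g w + f w * (- Q w * g w))%C by ring.
  apply cderiv_mult; auto.
Qed.

Lemma ode_solution_neq_0 (q : nat -> C) (Q : C -> C) :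
  has_pseries q Q -> forall z, inD z -> psum (ode_coef q) z <> 0%C.
Proof.
  intros H z Hz E.
  destruct (ode_solution q Q H) as [_ [F0 HF]].
  assert (H' : has_pseries (fun n => -1 * q n)%C (fun w => - Q w)%C).
  { apply (has_pseries_ext _ _ _ _ (fun n => eq_refl)) with (2 := has_pseries_scal (-1)%C _ _ H).
    intros w _. simpl. ring. }
  destruct (ode_solution _ _ H') as [_ [G0 HG]].
  assert (T := ode_inverse _ _ Q F0 G0 HF HG z Hz). rewrite E in T.
  rewrite Cmult_0_l in T. apply RtoC_inj in T. lra.
Qed.

(** * The complex exponential *)

Definition Cexp (z : C) : C := (exp (fst z) * cos (snd z), exp (fst z) * sin (snd z)).

Lemma Cexp_plus (z w : C) : Cexp (z + w) = (Cexp z * Cexp w)%C.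
Proof.
  destruct z as [x y], w as [u v]. unfold Cexp, Cplus, Cmult; simpl.
  rewrite exp_plus, cos_plus, sin_plus. f_equal; ring.
Qed.

Lemma Cexp_0 : Cexp 0%C = 1%C.
Proof. unfold Cexp, RtoC; simpl. rewrite exp_0, cos_0, sin_0. f_equal; ring. Qed.

Lemma Ccosh_Cexp (z : C) : Ccosh z = (/ 2 * (Cexp z + Cexp (- z)))%C.
Proof.
  destruct z as [x y]. unfold Ccosh, Cexp, cosh, sinh. simpl.
  rewrite cos_neg, sin_neg, <- RtoC_inv by lra. unfold RtoC, Cmult, Cplus. simpl. f_equal; field.
Qed.

Lemma Cexp_cderiv_0 : cderiv Cexp 0%C 1%C.
Proof.
  intros eps Heps.
  assert (De : derivable_pt_lim exp 0 1) by (rewrite <- exp_0; apply derivable_pt_lim_exp).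
  assert (Dc : derivable_pt_lim cos 0 0).
  { replace 0 with (- sin 0) at 2 by (rewrite sin_0; ring). apply derivable_pt_lim_cos. }
  assert (Ds : derivable_pt_lim sin 0 1) by (rewrite <- cos_0; apply derivable_pt_lim_sin).
  assert (W : forall f l, derivable_pt_lim f 0 l -> forall e, 0 < e -> exists del, 0 < del /\
    forall h, Rabs h < del -> Rabs (f h - f 0 - l * h) <= e * Rabs h).
  { intros f l Hf e He. destruct (Hf e He) as [del Hdel]. exists del. split; [apply cond_pos|].
    intros h Hh. destruct (Req_dec h 0) as [->|Hh0].
    - replace (f 0 - f 0 - l * 0) with 0 by ring. rewrite Rabs_R0. lra.
    - specialize (Hdel h Hh0 Hh). rewrite Rplus_0_l in Hdel.
      replace (f h - f 0 - l * h) with (((f h - f 0) / h - l) * h) by (field; exact Hh0).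
      rewrite Rabs_mult. apply Rmult_le_compat_r; [apply Rabs_pos|lra]. }
  (* With m = |x + iy| < e/2 and e <= 1, one has exp x <= 3 and |ex + x| <= e. The four error terms
     are then at most 3em, em, 3em and em, in total 8em; hence eps/8. *)
  set (e := Rmin (eps / 8) 1). assert (He : 0 < e) by (apply Rmin_pos; lra).
  assert (He1 : e <= eps / 8) by apply Rmin_l. assert (He2 : e <= 1) by apply Rmin_r.
  destruct (W _ _ De e He) as [d1 [Hd1 W1]]. destruct (W _ _ Dc e He) as [d2 [Hd2 W2]].
  destruct (W _ _ Ds e He) as [d3 [Hd3 W3]].
  rewrite exp_0 in W1. rewrite cos_0 in W2. rewrite sin_0 in W3.
  exists (Rmin (Rmin d1 d2) (Rmin d3 (e / 2))). split.
  { repeat apply Rmin_pos; lra. }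
  intros [x y] Hw. rewrite Cexp_0.
  assert (Z : forall u : C, (u - 0)%C = u) by (intros u; ring). rewrite Z in *.
  assert (Hx := fst_le_Cmod (x, y)). assert (Hy := snd_le_Cmod (x, y)). simpl in Hx, Hy.
  set (m := Cmod (x, y)) in *.
  assert (M1 := Rlt_le_trans _ _ _ Hw (Rmin_l _ _)). assert (M2 := Rlt_le_trans _ _ _ Hw (Rmin_r _ _)).
  assert (M11 := Rlt_le_trans _ _ _ M1 (Rmin_l _ _)). assert (M12 := Rlt_le_trans _ _ _ M1 (Rmin_r _ _)).
  assert (M21 := Rlt_le_trans _ _ _ M2 (Rmin_l _ _)). assert (M22 := Rlt_le_trans _ _ _ M2 (Rmin_r _ _)).
  specialize (W1 x ltac:(lra)). specialize (W2 y ltac:(lra)). specialize (W3 y ltac:(lra)).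
  eapply Rle_trans; [apply Cmod_le_fst_snd|].
  change (fst (Cexp (x, y) - 1 - 1 * (x, y))%C) with (exp x * cos y - 1 + - (1 * x - 0 * y)).
  change (snd (Cexp (x, y) - 1 - 1 * (x, y))%C) with (exp x * sin y - 0 + - (1 * y + 0 * x)).
  set (ex := exp x - 1 - 1 * x) in *. set (cy := cos y - 1 - 0 * y) in *.
  set (sy := sin y - 0 - 1 * y) in *.
  replace (exp x * cos y - 1 + - (1 * x - 0 * y)) with (exp x * cy + ex) by (unfold ex, cy; ring).
  replace (exp x * sin y - 0 + - (1 * y + 0 * x)) with (exp x * sy + (ex + x) * y) by (unfold ex, sy; ring).
  assert (Hm : 0 <= m) by apply Cmod_ge_0.
  assert (X := Rabs_pos x). assert (Y := Rabs_pos y).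
  assert (A1 : Rabs ex <= e * m) by nra. assert (A2 : Rabs cy <= e * m) by nra.
  assert (A3 : Rabs sy <= e * m) by nra.
  assert (Hexp : 0 < exp x <= 3).
  { split; [apply exp_pos|]. replace (exp x) with (1 + x + ex) by (unfold ex; ring).
    assert (T1 := Rle_abs x). assert (T2 := Rle_abs ex). nra. }
  assert (B1 : Rabs (exp x * cy) <= 3 * (e * m)).
  { rewrite Rabs_mult, (Rabs_pos_eq (exp x)) by lra. apply Rmult_le_compat; [lra|apply Rabs_pos|lra|lra]. }
  assert (B2 : Rabs (exp x * sy) <= 3 * (e * m)).
  { rewrite Rabs_mult, (Rabs_pos_eq (exp x)) by lra. apply Rmult_le_compat; [lra|apply Rabs_pos|lra|lra]. }
  assert (B3 : Rabs ((ex + x) * y) <= e * m).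
  { rewrite Rabs_mult. assert (T := Rabs_triang ex x).
    assert (Rabs (ex + x) <= e) by nra. assert (0 <= Rabs (ex + x)) by apply Rabs_pos. nra. }
  assert (T1 := Rabs_triang (exp x * cy) ex). assert (T2 := Rabs_triang (exp x * sy) ((ex + x) * y)).
  nra.
Qed.

Lemma Cexp_cderiv (z : C) : cderiv Cexp z (Cexp z).
Proof.
  assert (Hz : 0 < Cmod (Cexp z) + 1) by (assert (T := Cmod_ge_0 (Cexp z)); lra).
  intros eps Heps.
  destruct (Cexp_cderiv_0 (eps / (Cmod (Cexp z) + 1))) as [del [Hd H]].
  { apply Rdiv_lt_0_compat; lra. }
  exists del. split; [exact Hd|]. intros w Hw.
  specialize (H (w - z)%C). rewrite Cexp_0 in H. replace (w - z - 0)%C with (w - z)%C in H by ring.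
  specialize (H Hw). replace (Cexp w) with (Cexp z * Cexp (w - z))%C
    by (rewrite <- Cexp_plus; f_equal; ring).
  replace (Cexp z * Cexp (w - z) - Cexp z - Cexp z * (w - z))%C
    with (Cexp z * (Cexp (w - z) - 1 - 1 * (w - z)))%C by ring.
  rewrite Cmod_mult. assert (T := Cmod_ge_0 (Cexp z)). assert (T' := Cmod_ge_0 (w - z)).
  eapply Rle_trans; [apply Rmult_le_compat_l; [exact T|exact H]|].
  apply Rmult_le_reg_r with (Cmod (Cexp z) + 1); [lra|].
  replace (Cmod (Cexp z) * (eps / (Cmod (Cexp z) + 1) * Cmod (w - z)) * (Cmod (Cexp z) + 1))
    with (Cmod (Cexp z) * (eps * Cmod (w - z))) by (field; lra).
  assert (0 <= eps * Cmod (w - z)) by (apply Rmult_le_pos; lra). nra.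
Qed.

(** The series solution E of E' = omega' E and the function exp(-omega) satisfy equations with
    opposite coefficients and equal 1 at 0, so E exp(-omega) = 1. Multiplying by exp(omega)
    identifies E. *)
Lemma Cexp_pseries (w : nat -> C) (om : C -> C) :
  has_pseries w om -> om 0%C = 0%C ->
  has_pseries (ode_coef (dcoef w)) (fun z => Cexp (om z)).
Proof.
  intros H H0. assert (Hd := psum_correct _ (summable_dcoef _ (has_pseries_summable _ _ H))).
  destruct (ode_solution _ _ Hd) as [HE [E0 DE]].
  apply (has_pseries_ext _ _ _ _ (fun n => eq_refl)) with (2 := HE).
  intros z Hz. set (E := psum (ode_coef (dcoef w))) in *.
  assert (T : (E z * Cexp (- om z))%C = 1%C).
  { apply (ode_inverse E (fun z => Cexp (- om z)) (psum (dcoef w))); auto.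
    - rewrite H0. replace (- 0)%C with (RtoC 0) by ring. apply Cexp_0.
    - intros u Hu. apply (cderiv_comp Cexp (fun z => - om z)%C); [apply Cexp_cderiv|].
      intros eps Heps. destruct (has_pseries_cderiv w om u H Hu eps Heps) as [del [Hdel K]].
      exists del. split; [exact Hdel|]. intros v Hv. rewrite <- Cmod_opp.
      replace (- (- om v - - om u - - psum (dcoef w) u * (v - u)))%C
        with (om v - om u - psum (dcoef w) u * (v - u))%C by ring.
      apply K, Hv. }
  assert (T2 : (Cexp (om z) * Cexp (- om z))%C = 1%C).
  { rewrite <- Cexp_plus. replace (om z + - om z)%C with (RtoC 0) by ring. apply Cexp_0. }
  replace (E z) with (E z * Cexp (- om z) * Cexp (om z))%C.
  - rewrite T. ring.
  - rewrite <- Cmult_assoc, (Cmult_comm (Cexp (- om z))), T2. ring.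
Qed.

(** * Coefficients of starlike functions *)

Definition phi_coef (w : nat -> C) (n : nat) : C :=
  (w n + / 2 * (ode_coef (dcoef w) n + ode_coef (dcoef (fun k => -1 * w k)) n))%C.

Lemma phi_pseries (w : nat -> C) (om : C -> C) :
  has_pseries w om -> om 0%C = 0%C ->
  has_pseries (phi_coef w) (fun z => phi_ch (om z)).
Proof.
  intros H H0. assert (Hm := has_pseries_scal (-1)%C w om H).
  assert (E1 := Cexp_pseries w om H H0).
  assert (E2 := Cexp_pseries _ _ Hm ltac:(simpl; rewrite H0; ring)).
  apply (has_pseries_ext _ _ _ _ (fun n => eq_refl)) with
    (2 := has_pseries_plus _ _ _ _ H (has_pseries_scal (/ 2)%C _ _ (has_pseries_plus _ _ _ _ E1 E2))).
  intros z _. unfold phi_ch. rewrite Ccosh_Cexp. simpl.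
  replace (-1 * om z)%C with (- om z)%C by ring. reflexivity.
Qed.

Lemma ode_coef_0 (q : nat -> C) : ode_coef q 0 = 1%C.
Proof. reflexivity. Qed.

Lemma ode_coef_1 (q : nat -> C) : ode_coef q 1 = q O.
Proof.
  assert (E := ode_coef_S q 0). unfold conv in E. simpl csum in E. simpl INR in E.
  rewrite ode_coef_0 in E. replace (ode_coef q 1) with (1 * ode_coef q 1)%C by ring.
  rewrite E. ring.
Qed.

Lemma ode_coef_2 (q : nat -> C) : ode_coef q 2 = (/ 2 * (q O * q O + q 1%nat))%C.
Proof.
  assert (E := ode_coef_S q 1). unfold conv in E. simpl csum in E. simpl INR in E.
  rewrite ode_coef_0, ode_coef_1 in E. rewrite RtoC_plus in E.
  replace (ode_coef q 2) with (/ 2 * ((1 + 1) * ode_coef q 2))%C by field.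
  rewrite E. ring.
Qed.

Lemma ode_coef_3 (q : nat -> C) :
  ode_coef q 3 = (/ 6 * (q O * q O * q O + 3 * q O * q 1%nat + 2 * q 2%nat))%C.
Proof.
  assert (E := ode_coef_S q 2). unfold conv in E. simpl csum in E. simpl INR in E.
  rewrite ode_coef_0, ode_coef_1, ode_coef_2 in E. rewrite !RtoC_plus in E.
  replace (ode_coef q 3) with (/ 3 * ((1 + 1 + 1) * ode_coef q 3))%C by field.
  rewrite E. field.
Qed.

Lemma phi_coef_low (w : nat -> C) : w O = 0%C ->
  phi_coef w 0 = 1%C /\ phi_coef w 1 = w 1%nat /\
  phi_coef w 2 = (w 2%nat + / 2 * (w 1%nat * w 1%nat))%C /\
  phi_coef w 3 = (w 3%nat + w 1%nat * w 2%nat)%C.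
Proof.
  intros H0. unfold phi_coef.
  rewrite !ode_coef_0, !ode_coef_1, !ode_coef_2, !ode_coef_3. unfold dcoef. simpl INR.
  rewrite H0, !RtoC_plus. repeat split; field.
Qed.

(** In the multiplied form z f' = f phi(omega) both sides are power series on the whole disk, so
    uniqueness equates coefficients. The coefficient of z^n reads (n - 1) a_n = an expression in
    earlier a_k and the coefficients of phi(omega). *)
Lemma starlike_coef (f : C -> C) (a w : nat -> C) (om : C -> C) :
  has_pseries a f -> f 0%C = 0%C -> cderiv f 0%C 1%C ->
  has_pseries w om -> om 0%C = 0%C ->
  (forall z d, inD z -> z <> 0%C -> cderiv f z d -> (z * d = f z * phi_ch (om z))%C) ->
  a 2%nat = w 1%nat /\ a 3%nat = (/ 2 * w 2%nat + 3 / 4 * (w 1%nat * w 1%nat))%C /\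
  a 4%nat = (/ 3 * w 3%nat + 5 / 6 * (w 1%nat * w 2%nat)
             + 5 / 12 * (w 1%nat * w 1%nat * w 1%nat))%C.
Proof.
  intros Ha F0 F1 Hw O0 HE.
  assert (A0 : a O = 0%C) by (rewrite <- F0; symmetry; apply has_pseries_at_0, Ha).
  assert (W0 : w O = 0%C) by (rewrite <- O0; symmetry; apply has_pseries_at_0, Hw).
  assert (Hd := psum_correct _ (summable_dcoef _ (has_pseries_summable _ _ Ha))).
  assert (D0 : inD 0%C) by (unfold inD; rewrite Cmod_0; lra).
  assert (A1 : a 1%nat = 1%C).
  { rewrite (cderiv_unique _ _ _ _ F1 (has_pseries_cderiv a f 0%C Ha D0)).
    rewrite (has_pseries_at_0 _ _ Hd). unfold dcoef. simpl. ring. }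
  assert (Hm := has_pseries_mult _ _ _ _ Ha (phi_pseries w om Hw O0)).
  assert (E : forall n, shift1 (dcoef a) n = conv a (phi_coef w) n).
  { apply (has_pseries_unique _ _ (fun z => f z * phi_ch (om z))%C); [|exact Hm].
    apply (has_pseries_ext _ _ _ _ (fun n => eq_refl)) with (2 := has_pseries_shift1 _ _ Hd).
    (* The hypothesis covers only z <> 0; at 0 both sides vanish. *)
    intros z Hz. simpl. destruct (Ceq_dec z 0%C) as [->|Hz0].
    - rewrite F0. ring.
    - apply HE; auto. apply has_pseries_cderiv; assumption. }
  destruct (phi_coef_low w W0) as [P0 [P1 [P2 P3]]].
  assert (E2 := E 2%nat). assert (E3 := E 3%nat). assert (E4 := E 4%nat).
  unfold conv, shift1, dcoef in E2, E3, E4. simpl csum in E2, E3, E4. simpl INR in E2, E3, E4.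
  rewrite P0, P1, P2, ?P3, A0, A1, ?RtoC_plus in *.
  assert (X2 : a 2%nat = w 1%nat).
  { replace (a 2%nat) with ((1 + 1) * a 2%nat - a 2%nat)%C by ring. rewrite E2. ring. }
  rewrite X2 in *.
  assert (X3 : a 3%nat = (/ 2 * w 2%nat + 3 / 4 * (w 1%nat * w 1%nat))%C).
  { replace (a 3%nat) with (/ 2 * ((1 + 1 + 1) * a 3%nat - a 3%nat))%C by field. rewrite E3. field. }
  rewrite X3 in *. split; [reflexivity|split; [reflexivity|]].
  replace (a 4%nat) with (/ 3 * ((1 + 1 + 1 + 1) * a 4%nat - a 4%nat))%C by field. rewrite E4. field.
Qed.

Lemma H21_starlike (a w : nat -> C) :
  a 2%nat = w 1%nat -> a 3%nat = (/ 2 * w 2%nat + 3 / 4 * (w 1%nat * w 1%nat))%C ->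
  a 4%nat = (/ 3 * w 3%nat + 5 / 6 * (w 1%nat * w 2%nat)
             + 5 / 12 * (w 1%nat * w 1%nat * w 1%nat))%C ->
  H21 a = (/ 48 * (9 / 4 * (w 1%nat * w 1%nat * w 1%nat * w 1%nat)
    - 5 * (w 1%nat * w 1%nat * w 2%nat) - 3 * (w 2%nat * w 2%nat)
    + 4 * (w 1%nat * w 3%nat)))%C.
Proof.
  intros E2 E3 E4. unfold H21, Gamma1, Gamma2, Gamma3. rewrite E2, E3, E4. field.
Qed.

Lemma Cmod_H21 (a : nat -> C) :
  Cmod (H21 a) =
    / 48 * Cmod (13 * (a 2%nat * a 2%nat * a 2%nat * a 2%nat)
                 - 12 * (a 2%nat * a 2%nat * a 3%nat)
                 - 12 * (a 3%nat * a 3%nat)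
                 + 12 * (a 2%nat * a 4%nat))%C.
Proof.
  rewrite <- (Rabs_pos_eq (/ 48)) by lra. rewrite <- Cmod_R, <- Cmod_mult. f_equal.
  rewrite RtoC_inv by lra. unfold H21, Gamma1, Gamma2, Gamma3. field.
Qed.

(** * Construction of the extremal function *)

Lemma has_pseries_const (x : C) :
  has_pseries (fun n => match n with O => x | S _ => 0%C end) (fun _ => x).
Proof.
  intros z _ eps Heps. exists 1%nat. intros [|n] Hn; [lia|]. rewrite csum_first.
  rewrite (csum_ext _ (fun _ => 0%C)) by (intros; simpl; ring). rewrite csum_zero.
  replace (x * z ^ 0 + 0 - x)%C with (RtoC 0) by (simpl; ring). rewrite Cmod_0. exact Heps.
Qed.

(** Taylor coefficients of z (z + c) / (1 + c z), read off from (z + c) / (1 + c z) = c + (1 - c^2)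
    z / (1 + c z). *)
Definition blaschke_coef (c : R) (n : nat) : C :=
  match n with
  | O => 0%C
  | S O => RtoC c
  | S (S m) => RtoC ((1 - c * c) * (- c) ^ m)
  end.

Lemma blaschke_coef_summable (c : R) : -1 < c < 1 -> summable_on_D (blaschke_coef c).
Proof.
  intros Hc r Hr. assert (B : forall n, Cmod (blaschke_coef c n) <= 1).
  { assert (Ha : Rabs c <= 1) by (apply Rabs_le; lra).
    intros [|[|n]]; simpl; rewrite ?Cmod_0, ?Cmod_R; [lra|exact Ha|].
    rewrite Rabs_mult, <- RPow_abs, Rabs_Ropp.
    assert (P := pow_incr (Rabs c) 1 n (conj (Rabs_pos c) Ha)). rewrite pow1 in P.
    assert (0 <= Rabs c ^ n) by (apply pow_le, Rabs_pos).
    assert (Rabs (1 - c * c) <= 1) by (apply Rabs_le; nra).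
    assert (0 <= Rabs (1 - c * c)) by apply Rabs_pos. nra. }
  apply (ex_series_le (K := R_AbsRing) (V := R_CompleteNormedModule) _ (fun n => r ^ n)).
  - intros n. change (Rabs (Cmod (blaschke_coef c n) * r ^ n) <= r ^ n).
    assert (P : 0 <= r ^ n) by (apply pow_le; lra). assert (T := Cmod_ge_0 (blaschke_coef c n)).
    rewrite Rabs_pos_eq by (apply Rmult_le_pos; lra). specialize (B n). nra.
  - exists (/ (1 - r)). apply is_series_geom. rewrite Rabs_pos_eq; lra.
Qed.

Lemma blaschke_psum (c : R) (z : C) : -1 < c < 1 -> inD z ->
  (psum (blaschke_coef c) z * (1 + RtoC c * z) = z * (z + RtoC c))%C.
Proof.
  intros Hc Hz. assert (H := psum_correct _ (blaschke_coef_summable c Hc)).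
  set (om := psum (blaschke_coef c)) in *.
  assert (H1 := has_pseries_plus _ _ _ _ H (has_pseries_scal (RtoC c) _ _ (has_pseries_shift1 _ _ H))).
  assert (H2 := has_pseries_shift1 _ _ (has_pseries_plus _ _ _ _ (has_pseries_const (RtoC c))
    (has_pseries_shift1 _ _ (has_pseries_const 1%C)))).
  replace (om z * (1 + RtoC c * z))%C with (om z + RtoC c * (z * om z))%C by ring.
  replace (z * (z + RtoC c))%C with (z * (RtoC c + z * 1))%C by ring.
  apply (cser_unique _ _ _ (H1 z Hz)). eapply cser_ext; [|exact (H2 z Hz)].
  intros [|[|[|n]]]; simpl; rewrite ?RtoC_mult, ?RtoC_minus, ?RtoC_mult, ?RtoC_opp; ring.
Qed.

(** |1 + cz|^2 - |z + c|^2 = (1 - |z|^2)(1 - c^2) > 0, so the Blaschke factor has modulus below 1,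
    and the additional factor z preserves this. *)
Lemma blaschke_lt_1 (c : R) (z : C) : -1 < c < 1 -> inD z -> Cmod (psum (blaschke_coef c) z) < 1.
Proof.
  intros Hc Hz. assert (E := f_equal Cmod (blaschke_psum c z Hc Hz)).
  rewrite !Cmod_mult in E. unfold inD in Hz.
  set (m := Cmod (psum (blaschke_coef c) z)) in *.
  assert (Q1 := Cmod2_alt (1 + RtoC c * z)%C). assert (Q2 := Cmod2_alt (z + RtoC c)%C).
  assert (Q3 := Cmod2_alt z). destruct z as [x y]. simpl in Q1, Q2, Q3.
  set (p := Cmod (1 + RtoC c * (x, y))) in *. set (q := Cmod ((x, y) + RtoC c)) in *.
  set (r := Cmod (x, y)) in *.
  assert (Hp : 0 <= p) by apply Cmod_ge_0. assert (Hq : 0 <= q) by apply Cmod_ge_0.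
  assert (Hr : 0 <= r) by apply Cmod_ge_0. assert (Hm : 0 <= m) by apply Cmod_ge_0.
  assert (D : p * p - q * q = (1 - r * r) * (1 - c * c)) by nra.
  assert (0 < (1 - r * r) * (1 - c * c)) by (apply Rmult_lt_0_compat; nra).
  assert (q < p) by nra. nra.
Qed.

(** Every admissible [om] is realised, so sharpness becomes a choice of [om]. For f = z h one has z
    f'/f = 1 + z h'/h, which is why [q] must represent (phi(omega) - 1) / z. *)
Lemma Sch_exists (w : nat -> C) (om : C -> C) :
  has_pseries w om -> om 0%C = 0%C -> (forall z, inD z -> Cmod (om z) < 1) ->
  exists (f : C -> C) (a : nat -> C), Sch f /\ has_pseries a f /\
    H21 a = (/ 48 * (9 / 4 * (w 1%nat * w 1%nat * w 1%nat * w 1%nat)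
      - 5 * (w 1%nat * w 1%nat * w 2%nat) - 3 * (w 2%nat * w 2%nat)
      + 4 * (w 1%nat * w 3%nat)))%C.
Proof.
  intros Hw O0 O1.
  assert (W0 : w O = 0%C) by (rewrite <- O0; symmetry; apply has_pseries_at_0, Hw).
  assert (Hphi := phi_pseries w om Hw O0).
  set (q := fun n => phi_coef w (S n)).
  (* Removing one factor z costs a factor 1/s; comparing at s > r keeps this finite even when r =
     0. *)
  assert (Hq : has_pseries q (psum q)).
  { apply psum_correct. intros r Hr. set (s := (1 + r) / 2).
    assert (Hs : 0 < s < 1) by (unfold s; lra).
    assert (E := has_pseries_summable _ _ Hphi s ltac:(lra)).
    apply (ex_series_incr_1 (K := R_AbsRing) (V := R_NormedModule)) in E.
    apply (ex_series_scal (K := R_AbsRing) (V := R_NormedModule) (/ s)) in E.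
    revert E. apply (ex_series_le (K := R_AbsRing) (V := R_CompleteNormedModule)).
    intros n. change (Rabs (Cmod (q n) * r ^ n) <= / s * (Cmod (q n) * (s * s ^ n))).
    assert (0 <= r ^ n) by (apply pow_le; lra). assert (T := Cmod_ge_0 (q n)).
    assert (r ^ n <= s ^ n) by (apply pow_incr; unfold s; lra).
    rewrite Rabs_pos_eq by (apply Rmult_le_pos; lra).
    replace (/ s * (Cmod (q n) * (s * s ^ n))) with (Cmod (q n) * s ^ n) by (field; lra).
    apply Rmult_le_compat_l; lra. }
  assert (HQ : forall z, inD z -> (phi_ch (om z) = 1 + z * psum q z)%C).
  { intros z Hz. apply (cser_unique _ _ _ (Hphi z Hz)).
    replace (1 + z * psum q z)%C with (phi_coef w 0 * z ^ 0 + z * psum q z)%C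
      by (rewrite (proj1 (phi_coef_low w W0)); simpl; ring).
    apply (cser_shift (fun n => phi_coef w n * z ^ n)%C).
    eapply cser_ext; [|exact (cser_scal z _ _ (Hq z Hz))]. intros n. unfold q. simpl. ring. }
  destruct (ode_solution q _ Hq) as [Hh [H0 Dh]].
  assert (Hnz := ode_solution_neq_0 q _ Hq).
  set (h := psum (ode_coef q)) in *.
  set (f := fun z => (z * h z)%C). set (a := shift1 (ode_coef q)).
  assert (Ha : has_pseries a f) by (apply has_pseries_shift1, Hh).
  assert (Df : forall z, inD z -> cderiv f z (h z + z * (psum q z * h z))%C).
  { intros z Hz. replace (h z) with (1 * h z)%C at 1 by ring.
    apply (cderiv_mult (fun z => z)); [|apply Dh, Hz].
    intros eps Heps. exists 1. split; [lra|]. intros v _.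
    replace (v - z - 1 * (v - z))%C with (RtoC 0) by ring. rewrite Cmod_0.
    apply Rmult_le_pos; [lra|apply Cmod_ge_0]. }
  assert (D0 : inD 0%C) by (unfold inD; rewrite Cmod_0; lra).
  assert (F0 : f 0%C = 0%C) by (unfold f; ring).
  assert (F1 : cderiv f 0%C 1%C).
  { assert (T := Df _ D0). rewrite H0 in T.
    replace (1 + 0 * (psum q 0%C * 1))%C with (RtoC 1) in T by ring. exact T. }
  exists f, a. split; [|split; [exact Ha|]].
  - split.
    + split; [|split; [exact F0|apply is_derive_cderiv, F1]].
      exists a. apply has_pseries_iff, Ha.
    + exists om. split; [exists w; apply has_pseries_iff, Hw|].
      split; [exact O0|split; [exact O1|]].
      intros z Hz Hz0. assert (Fz : f z <> 0%C) by (apply Cmult_neq_0; auto).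
      split; [exact Fz|]. eexists. split; [apply is_derive_cderiv, Df, Hz|].
      rewrite HQ by exact Hz. unfold f. field. split; auto.
  - destruct (starlike_coef f a w om Ha F0 F1 Hw O0) as [E2 [E3 E4]].
    + intros z d Hz Hz0 Hd. rewrite (cderiv_unique _ _ _ _ Hd (Df z Hz)), HQ by exact Hz.
      unfold f. ring.
    + apply H21_starlike; assumption.
Qed.

Lemma extremal_Sch :
  exists (f : C -> C) (a : nat -> C), Sch f /\ has_pseries a f /\ Cmod (H21 a) = 3 / 44.
Proof.
  set (c := sqrt (2 / 11)).
  assert (Hcc : c * c = 2 / 11) by (apply sqrt_sqrt; lra).
  assert (Hc0 : 0 <= c) by apply sqrt_pos.
  assert (Hc : -1 < c < 1) by nra.
  assert (Hw := psum_correct _ (blaschke_coef_summable c Hc)).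
  destruct (Sch_exists _ _ Hw (has_pseries_at_0 _ _ Hw)
    (fun z Hz => blaschke_lt_1 c z Hc Hz)) as [f [a [Hf [Ha E]]]].
  exists f, a. split; [exact Hf|split; [exact Ha|]]. rewrite E. simpl blaschke_coef.
  (* Here w_1 = c, w_2 = 1 - c^2, w_3 = -c (1 - c^2). With u = c^2 the bracket is (33/4) u^2 - 3u -
     3, which equals -36/11 at u = 2/11. *)
  replace (/ 48 * _)%C with (RtoC (- (3 / 44))).
  - rewrite Cmod_R, Rabs_Ropp, Rabs_pos_eq; lra.
  - replace (- (3 / 44)) with (/ 48 * (9 / 4 * ((c * c) * (c * c)) - 5 * ((c * c) * (1 - c * c))
      - 3 * ((1 - c * c) * (1 - c * c)) - 4 * (c * c * (1 - c * c)))) by (rewrite Hcc; field).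
    unfold RtoC, Cmult, Cplus, Cminus, Copp, Cinv, Cdiv; simpl.
    apply injective_projections; simpl; field.
Qed.

(** * Schur's inequalities *)

Definition cis (x : R) : C := (cos x, sin x).

Lemma cis_plus (x y : R) : cis (x + y) = (cis x * cis y)%C.
Proof. unfold cis, Cmult; simpl. rewrite cos_plus, sin_plus. f_equal; ring. Qed.

Lemma cis_pow (x : R) (n : nat) : (cis x ^ n)%C = cis (INR n * x).
Proof.
  induction n as [|n IH].
  - unfold cis, RtoC. simpl. rewrite Rmult_0_l, cos_0, sin_0. reflexivity.
  - change (cis x ^ S n)%C with (cis x * cis x ^ n)%C.
    rewrite IH, <- cis_plus, S_INR. f_equal. ring.
Qed.

Lemma Cconj_cis (x : R) : Cconj (cis x) = cis (- x).
Proof. unfold cis, Cconj; simpl. now rewrite cos_neg, sin_neg. Qed.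

Lemma Cmod_cis (x : R) : Cmod (cis x) = 1.
Proof.
  assert (E := Cmod2_alt (cis x)). simpl in E.
  assert (H := sin2_cos2 x). unfold Rsqr in H. assert (T := Cmod_ge_0 (cis x)). nra.
Qed.

Lemma cis_2PI : cis (2 * PI) = 1%C.
Proof. unfold cis. now rewrite cos_2PI, sin_2PI. Qed.

Lemma cis_neq_1 (x : R) : 0 < Rabs x < 2 * PI -> cis x <> 1%C.
Proof.
  intros Hx E. assert (Ec : cos x = 1) by exact (f_equal fst E).
  assert (Ea : cos (Rabs x) = 1).
  { destruct (Rcase_abs x); [rewrite Rabs_left, cos_neg|rewrite Rabs_right]; assumption. }
  replace (Rabs x) with (2 * (Rabs x / 2)) in Ea by field. rewrite cos_2a_sin in Ea.
  assert (S0 : 0 < sin (Rabs x / 2)) by (apply sin_gt_0; lra). nra.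
Qed.

Lemma csum_geom (v : C) (n : nat) : (csum (fun j => v ^ j) n * (1 - v) = 1 - v ^ n)%C.
Proof.
  induction n as [|n IH]; simpl; [ring|].
  replace ((csum (fun j => v ^ j) n + v ^ n) * (1 - v))%C
    with (csum (fun j => v ^ j) n * (1 - v) + v ^ n * (1 - v))%C by ring.
  rewrite IH. ring.
Qed.

Lemma csum_const (x : C) (n : nat) : csum (fun _ => x) n = (RtoC (INR n) * x)%C.
Proof. induction n as [|n IH]; [simpl; ring|]. rewrite S_INR, RtoC_plus. simpl csum. rewrite IH. ring. Qed.

Lemma csum_delta (x : nat -> C) (m n : nat) :
  (m < n)%nat -> csum (fun k => if Nat.eqb m k then x k else 0%C) n = x m.
Proof.
  intros H. assert (Z : forall k, (k <= m)%nat ->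
    csum (fun k => if Nat.eqb m k then x k else 0%C) k = 0%C).
  { intros k Hk. rewrite (csum_ext _ (fun _ => 0%C)); [apply csum_zero|].
    intros i Hi. now rewrite (proj2 (Nat.eqb_neq m i)) by lia. }
  induction H as [|n Hn IH]; simpl.
  - rewrite Z, Nat.eqb_refl by lia. ring.
  - rewrite IH, (proj2 (Nat.eqb_neq m n)) by lia. ring.
Qed.

Definition root1 (N : nat) : C := cis (2 * PI / INR N).

(** For m <> n the ratio has angle (m - n) 2 PI / N with |m - n| < N. It is therefore an N-th root
    of unity different from 1, and its geometric sum vanishes. *)
Lemma root1_orthogonal (N m n : nat) : (m < N)%nat -> (n < N)%nat ->
  csum (fun j => (root1 N ^ m * Cconj (root1 N ^ n)) ^ j)%C N =
    if Nat.eqb m n then RtoC (INR N) else 0%C.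
Proof.
  intros Hm Hn. assert (HN : 0 < INR N) by (apply lt_0_INR; lia).
  unfold root1. set (t := 2 * PI / INR N).
  assert (Ht : INR N * t = 2 * PI) by (unfold t; field; lra).
  rewrite !cis_pow, Cconj_cis, <- cis_plus.
  destruct (Nat.eqb_spec m n) as [->|Hmn].
  - rewrite (csum_ext _ (fun _ => 1%C)); [rewrite csum_const; ring|].
    intros j _. rewrite cis_pow. replace (INR j * (INR n * t + - (INR n * t))) with 0 by ring.
    unfold cis. now rewrite cos_0, sin_0.
  - set (v := cis (INR m * t + - (INR n * t))).
    assert (V1 : v <> 1%C).
    { apply cis_neq_1. replace (INR m * t + - (INR n * t)) with ((INR m - INR n) * t) by ring.
      assert (Tp : 0 < t) by (unfold t; apply Rdiv_lt_0_compat; [assert (P := PI_RGT_0); lra|exact HN]).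
      rewrite Rabs_mult, (Rabs_pos_eq t), <- Ht by lra. split.
      - apply Rmult_lt_0_compat; [|exact Tp]. apply Rabs_pos_lt. intros E. apply Hmn, INR_eq. lra.
      - apply Rmult_lt_compat_r; [exact Tp|].
        apply lt_INR in Hm. apply lt_INR in Hn.
        assert (A := pos_INR m). assert (B := pos_INR n). apply Rabs_def1; lra. }
    assert (VN : (v ^ N)%C = 1%C).
    { unfold v. rewrite cis_pow, Rmult_plus_distr_l, cis_plus.
      replace (INR N * (INR m * t)) with (INR m * (2 * PI)) by (rewrite <- Ht; ring).
      replace (INR N * - (INR n * t)) with (- (INR n * (2 * PI))) by (rewrite <- Ht; ring).
      rewrite <- Cconj_cis, <- !cis_pow, cis_2PI.
      assert (P1 : forall k, (1 ^ k)%C = 1%C).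
      { induction k as [|k IH]; [reflexivity|]. simpl. rewrite IH. ring. }
      rewrite !P1. unfold Cconj, RtoC, Cmult; simpl. f_equal; ring. }
    assert (G := csum_geom v N). rewrite VN in G.
    assert (H1 : (1 - v)%C <> 0%C).
    { intros E. apply V1. replace v with (1 - (1 - v))%C by ring. rewrite E. ring. }
    replace (csum _ N) with (csum (fun j => v ^ j)%C N * (1 - v) * / (1 - v))%C by (field; exact H1).
    rewrite G. ring.
Qed.

Lemma Cconj_csum (a : nat -> C) (n : nat) : Cconj (csum a n) = csum (fun k => Cconj (a k)) n.
Proof.
  induction n as [|n IH]; simpl; [unfold Cconj, RtoC; simpl; f_equal; ring|].
  rewrite <- IH. unfold Cconj, Cplus; simpl. f_equal; ring.
Qed.

Lemma Cconj_mult (x y : C) : Cconj (x * y) = (Cconj x * Cconj y)%C.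
Proof. unfold Cconj, Cmult; simpl. f_equal; ring. Qed.

Lemma Cconj_pow (x : C) (n : nat) : Cconj (x ^ n) = (Cconj x ^ n)%C.
Proof.
  induction n as [|n IH]; simpl; [unfold Cconj, RtoC; simpl; f_equal; ring|].
  now rewrite Cconj_mult, IH.
Qed.

Lemma RtoC_rsum (a : nat -> R) (n : nat) : RtoC (rsum a n) = csum (fun k => RtoC (a k)) n.
Proof. induction n as [|n IH]; simpl; [reflexivity|]. now rewrite RtoC_plus, IH. Qed.

(** The squared modulus expands into a double sum, and orthogonality keeps the diagonal. Since N
    points are used for N coefficients, no two indices agree modulo N and the average is exact. *)
Lemma discrete_parseval (a : nat -> C) (r : R) (N : nat) :
  rsum (fun j => Cmod (csum (fun n => a n * (RtoC r * root1 N ^ j) ^ n)%C N) ^ 2) N =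
  INR N * rsum (fun n => Cmod (a n) ^ 2 * (r ^ n) ^ 2) N.
Proof.
  apply RtoC_inj. rewrite RtoC_mult, !RtoC_rsum.
  rewrite (csum_ext _ (fun j => csum (fun m => csum (fun n =>
     (a m * Cconj (a n) * RtoC (r ^ m) * RtoC (r ^ n)) *
     (root1 N ^ m * Cconj (root1 N ^ n)) ^ j) N) N)%C).
  2:{ intros j Hj. rewrite Cmod2_conj, Cconj_csum, Cmult_comm, <- csum_scal.
    apply csum_ext. intros m Hm. rewrite Cmult_comm, <- csum_scal. apply csum_ext. intros n Hn.
    rewrite !Cconj_mult, !Cconj_pow, Cconj_mult, Cconj_pow, !Cpow_mult_l, <- !Cpow_mult_r, !RtoC_pow.
    rewrite (Nat.mul_comm j m), (Nat.mul_comm j n).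
    replace (Cconj (RtoC r)) with (RtoC r) by (unfold Cconj, RtoC; simpl; f_equal; ring). ring. }
  rewrite csum_swap, <- csum_scal. apply csum_ext. intros m Hm.
  rewrite csum_swap.
  rewrite (csum_ext _ (fun n => if Nat.eqb m n then
    (a m * Cconj (a n) * RtoC (r ^ m) * RtoC (r ^ n) * RtoC (INR N))%C else 0%C)).
  2:{ intros n Hn. rewrite csum_scal, root1_orthogonal by assumption.
    destruct (Nat.eqb m n); ring. }
  rewrite (csum_delta (fun n => (a m * Cconj (a n) * RtoC (r ^ m) * RtoC (r ^ n) * RtoC (INR N))%C) m N Hm).
  rewrite !RtoC_mult. rewrite Cmod2_conj.
  rewrite (RtoC_pow (r ^ m)). ring.
Qed.

Lemma csum_finite_support (p : nat -> C) (d N : nat) :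
  (forall n, (d <= n)%nat -> p n = 0%C) -> (d <= N)%nat -> csum p N = csum p d.
Proof.
  intros Hp H. induction H as [|N HN IH]; [reflexivity|]. simpl. rewrite IH, Hp by exact HN. ring.
Qed.

(* Averaging |g|^2 <= |p|^2 over the N-th roots of unity on |z| = r, then letting N -> oo and r -> 1. *)
Lemma parseval_le (b p : nat -> C) (g : C -> C) (d K : nat) :
  has_pseries b g -> (forall n, (d <= n)%nat -> p n = 0%C) ->
  (forall z, inD z -> Cmod (g z) <= Cmod (csum (fun n => p n * z ^ n)%C d)) ->
  rsum (fun n => Cmod (b n) ^ 2) K <= rsum (fun n => Cmod (p n) ^ 2) d.
Proof.
  intros Hb Hp Hg.
  set (B := rsum (fun n => Cmod (b n) ^ 2) K). set (Q := rsum (fun n => Cmod (p n) ^ 2) d).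
  assert (SQ : forall u n, 0 <= rsum (fun n => Cmod (u n) ^ 2) n).
  { intros u n. induction n as [|n IH]; cbn [rsum]; [lra|]. assert (T := pow2_ge_0 (Cmod (u n))). lra. }
  assert (HQ : 0 <= Q) by apply SQ. assert (HB : 0 <= B) by apply SQ.
  assert (Hsq : forall n, 0 <= Cmod (b n) ^ 2) by (intros; apply pow2_ge_0).
  assert (Main : forall r, 0 < r < 1 -> B * (r ^ K) ^ 2 <= Q).
  { intros r Hr. apply le_epsilon. intros eta Heta.
    (* Chosen so that (1 + e) Q + e (1 + e) <= Q + e (Q + 2) <= Q + eta, using e <= 1. *)
    set (e := Rmin 1 (eta / (Q + 2))).
    assert (He : 0 < e) by (apply Rmin_pos; [lra|apply Rdiv_lt_0_compat; lra]).
    assert (He1 : e <= 1) by apply Rmin_l.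
    assert (He2 : e * (Q + 2) <= eta).
    { apply Rle_trans with (eta / (Q + 2) * (Q + 2)); [|right; field; lra].
      apply Rmult_le_compat_r; [lra|apply Rmin_r]. }
    destruct (has_pseries_summable b g Hb r) as [S HS]; [lra|].
    destruct (proj1 (is_series_rsum _ _) HS e He) as [N0 HN0].
    set (N := Datatypes.S (max K (max d N0))).
    assert (HN : 0 < INR N) by (apply lt_0_INR; unfold N; lia).
    assert (Le : rsum (fun n => Cmod (b n) ^ 2 * (r ^ n) ^ 2) N <= (1 + e) * Q + e * (1 + e)).
    { apply Rmult_le_reg_l with (INR N); [exact HN|].
      rewrite <- discrete_parseval.
      assert (PP : rsum (fun j => Cmod (csum (fun n => p n * (RtoC r * root1 N ^ j) ^ n)%C N) ^ 2) N
        <= INR N * Q).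
      { rewrite discrete_parseval. apply Rmult_le_compat_l; [lra|].
        apply Rle_trans with (rsum (fun n => Cmod (p n) ^ 2) N).
        - apply rsum_le. intros k _.
          assert (R1 : 0 <= r ^ k) by (apply pow_le; lra).
          assert (R2 := pow_incr r 1 k ltac:(lra)). rewrite pow1 in R2.
          assert (T := pow2_ge_0 (Cmod (p k))). assert ((r ^ k) ^ 2 <= 1) by nra.
          rewrite <- (Rmult_1_r (Cmod (p k) ^ 2)) at 2. apply Rmult_le_compat_l; assumption.
        - right. assert (Hd : (d <= N)%nat) by (unfold N; lia). unfold Q. clear -Hp Hd.
          induction Hd as [|N HN IH]; [reflexivity|]. cbn [rsum]. rewrite IH, Hp, Cmod_0 by exact HN. ring. }
      (* (P + e)^2 <= (1 + e) P^2 + e (1 + e), the difference being e (P - 1)^2. The truncation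
         error then enters through the average of P^2 only, without a bound on P itself. *)
      apply Rle_trans with (rsum (fun j => (1 + e) *
        Cmod (csum (fun n => p n * (RtoC r * root1 N ^ j) ^ n)%C N) ^ 2 + e * (1 + e)) N).
      - apply rsum_le. intros j _. set (z := (RtoC r * root1 N ^ j)%C).
        assert (Hz : Cmod z = r).
        { unfold z. rewrite Cmod_mult, Cmod_R, Cmod_pow. unfold root1.
          rewrite Cmod_cis, pow1, Rabs_pos_eq; lra. }
        assert (Hz1 : inD z) by (unfold inD; lra).
        assert (T := cser_tail_le _ _ _ _ N (Cmod_term_le b z r ltac:(lra)) (Hb z Hz1) HS).
        assert (TN := HN0 N ltac:(unfold N; lia)). apply Rabs_def2 in TN.
        rewrite (csum_finite_support (fun n => p n * z ^ n)%C d N);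
          [|intros n Hn; rewrite Hp by exact Hn; ring|unfold N; lia].
        assert (G := Hg z Hz1).
        set (s := csum (fun n => b n * z ^ n)%C N) in *.
        set (P := Cmod (csum (fun n => p n * z ^ n)%C d)) in *.
        assert (Tr := Cmod_triangle (g z) (s - g z)).
        replace (g z + (s - g z))%C with s in Tr by ring.
        rewrite (Cmod_minus_sym s) in Tr.
        assert (Hs : Cmod s <= P + e) by (destruct TN; lra).
        assert (0 <= Cmod s) by apply Cmod_ge_0. assert (0 <= P) by apply Cmod_ge_0.
        assert (0 <= e * (P - 1) ^ 2) by (apply Rmult_le_pos; [lra|apply pow2_ge_0]).
        apply Rle_trans with ((P + e) ^ 2); [apply pow_incr; lra|]. nra.
      - assert (EQ : forall u x y n, rsum (fun j => x * u j + y) n = x * rsum u n + INR n * y).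
        { intros u x y n. induction n as [|n IH]; [simpl; ring|]. cbn [rsum]. rewrite IH, S_INR. ring. }
        rewrite EQ. nra. }
    apply Rle_trans with (rsum (fun n => Cmod (b n) ^ 2 * (r ^ n) ^ 2) N); [|nra].
    apply Rle_trans with (rsum (fun n => Cmod (b n) ^ 2 * (r ^ n) ^ 2) K).
    - unfold B. rewrite Rmult_comm, <- rsum_scal. apply rsum_le. intros k Hk.
      rewrite Rmult_comm. apply Rmult_le_compat_l; [apply Hsq|]. apply pow_incr. split; [apply pow_le; lra|].
      apply Rle_trans with (r ^ k * 1); [|lra].
      replace K with (k + (K - k))%nat by lia. rewrite pow_add.
      apply Rmult_le_compat_l; [apply pow_le; lra|].
      rewrite <- (pow1 (K - k)). apply pow_incr; lra.
    - apply rsum_incr; [intros; apply Rmult_le_pos; [apply Hsq|apply pow2_ge_0]|unfold N; lia]. }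
  (* Bernoulli's inequality makes the limit r -> 1 quantitative: with r = 1 - s, the factor r^(2K)
     loses at most 2K s. *)
  assert (Bern : forall s m, 0 <= s <= 1 -> 1 - INR m * s <= (1 - s) ^ m).
  { intros s m Hs. induction m as [|m IH]; [simpl; lra|]. rewrite S_INR.
    change ((1 - s) ^ S m) with ((1 - s) * (1 - s) ^ m). assert (I := pos_INR m).
    assert (0 <= (1 - s) * ((1 - s) ^ m - (1 - INR m * s))) by (apply Rmult_le_pos; lra).
    assert (0 <= INR m * (s * s)) by (apply Rmult_le_pos; nra). nra. }
  apply le_epsilon. intros eps Heps.
  set (M := INR (K * 2)). assert (HM : 0 <= M) by apply pos_INR.
  set (s := Rmin (1 / 2) (eps / (B * M + 1))).
  assert (BM : 0 <= B * M) by (apply Rmult_le_pos; lra).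
  assert (Hs : 0 < s) by (apply Rmin_pos; [lra|apply Rdiv_lt_0_compat; lra]).
  assert (Hs1 : s <= 1 / 2) by apply Rmin_l.
  assert (Hs2 : s * (B * M + 1) <= eps).
  { apply Rle_trans with (eps / (B * M + 1) * (B * M + 1)); [|right; field; lra].
    apply Rmult_le_compat_r; [lra|apply Rmin_r]. }
  assert (T := Main (1 - s) ltac:(lra)). rewrite <- pow_mult in T.
  assert (U := Bern s (K * 2)%nat ltac:(lra)). fold M in U.
  assert (B * (1 - M * s) <= B * (1 - s) ^ (K * 2)) by (apply Rmult_le_compat_l; lra).
  nra.
Qed.

(** Multiplication by omega does not increase |p| for p = p0 + p1 z + p2 z^2, so [parseval_le]
    bounds the low coefficients of omega p: the triangular Toeplitz matrix of w_1, w_2, w_3 is a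
    contraction. As w_0 = 0 these coefficients start at z^1, and four of them (K = 4) are kept to
    reach z^3. *)
Lemma schur_toeplitz_contraction (w : nat -> C) (om : C -> C) :
  has_pseries w om -> w O = 0%C -> (forall z, inD z -> Cmod (om z) < 1) ->
  forall p0 p1 p2 : C,
  Cmod (p0 * w 1%nat) ^ 2 + Cmod (p0 * w 2%nat + p1 * w 1%nat) ^ 2 +
  Cmod (p0 * w 3%nat + p1 * w 2%nat + p2 * w 1%nat) ^ 2 <=
  Cmod p0 ^ 2 + Cmod p1 ^ 2 + Cmod p2 ^ 2.
Proof.
  intros Hw W0 Hom p0 p1 p2.
  assert (H1 := has_pseries_shift1 _ _ Hw). assert (H2 := has_pseries_shift1 _ _ H1).
  assert (Hg := has_pseries_plus _ _ _ _ (has_pseries_plus _ _ _ _ (has_pseries_scal p0 _ _ Hw)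
    (has_pseries_scal p1 _ _ H1)) (has_pseries_scal p2 _ _ H2)).
  set (p := fun n => match n with O => p0 | S O => p1 | S (S O) => p2 | _ => 0%C end).
  assert (T := parseval_le _ p _ 3 4 Hg).
  cbn [rsum csum] in T. unfold p in T. cbn [shift1] in T. rewrite W0 in T.
  assert (T' : forall z, inD z -> Cmod (p0 * om z + p1 * (z * om z) + p2 * (z * (z * om z)))%C <=
    Cmod (0 + p0 * z ^ 0 + p1 * z ^ 1 + p2 * z ^ 2)%C).
  { intros z Hz. replace (p0 * om z + p1 * (z * om z) + p2 * (z * (z * om z)))%C
      with ((0 + p0 * z ^ 0 + p1 * z ^ 1 + p2 * z ^ 2) * om z)%C by (simpl; ring).
    rewrite Cmod_mult. specialize (Hom z Hz).
    assert (U := Cmod_ge_0 (0 + p0 * z ^ 0 + p1 * z ^ 1 + p2 * z ^ 2)%C).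
    assert (U' := Cmod_ge_0 (om z)). nra. }
  specialize (T ltac:(intros [|[|[|n]]] Hn; [lia|lia|lia|reflexivity]) T').
  replace (p0 * w 1%nat + p1 * 0 + p2 * 0)%C with (p0 * w 1%nat)%C in T by ring.
  replace (p0 * w 2%nat + p1 * w 1%nat + p2 * 0)%C with (p0 * w 2%nat + p1 * w 1%nat)%C in T by ring.
  assert (V := pow2_ge_0 (Cmod (p0 * 0 + p1 * 0 + p2 * 0)%C)). lra.
Qed.

(** With p0 = 1, the contraction inequality is strengthened by maximising over p2 and then p1; each
    is a concave quadratic, because |x| < 1 and then |y| < 1 - |x|^2. The degenerate case |y| = 1 -
    |x|^2 is settled without the second optimum. *)
Lemma toeplitz_contraction_schur (x y v : C) :
  (forall p0 p1 p2 : C,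
    Cmod (p0 * x) ^ 2 + Cmod (p0 * y + p1 * x) ^ 2 + Cmod (p0 * v + p1 * y + p2 * x) ^ 2 <=
    Cmod p0 ^ 2 + Cmod p1 ^ 2 + Cmod p2 ^ 2) ->
  Cmod x ^ 2 < 1 ->
  Cmod y <= 1 - Cmod x ^ 2 /\
  Cmod (v + / RtoC (1 - Cmod x ^ 2) * (Cconj x * (y * y))) * (1 - Cmod x ^ 2)
    <= (1 - Cmod x ^ 2) ^ 2 - Cmod y ^ 2.
Proof.
  intros H Hx. set (u := Cmod x ^ 2) in *. set (k := / (1 - u)).
  assert (Hk : k * (1 - u) = 1) by (unfold k; field; lra).
  assert (Hk0 : 0 < k) by (apply Rinv_0_lt_compat; lra).
  assert (Hu : RtoC u = (Cconj x * x)%C) by (unfold u; rewrite Cmod2_conj; ring).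
  assert (HkC : (RtoC k * (1 - RtoC u))%C = 1%C).
  { rewrite <- RtoC_minus, <- RtoC_mult, Hk. reflexivity. }
  rewrite <- RtoC_inv by lra. fold k. set (Y := (v + RtoC k * (Cconj x * (y * y)))%C).
  (* [p2] is the optimal choice for given [p1], and [eta] measures the deviation of [p1] from its optimum. *)
  assert (Key : forall eta : C,
    Cmod (Y + y * eta) ^ 2 - (1 - u) ^ 2 * Cmod eta ^ 2 <= (1 - u) ^ 2 - Cmod y ^ 2).
  { intros eta. set (p1 := (RtoC k * (Cconj x * y) + eta)%C).
    set (X := (Y + y * eta)%C).
    assert (T := H 1%C p1 (RtoC k * (Cconj x * X))%C).
    rewrite Cmult_1_l, !Cmult_1_l, Cmod_1 in T. fold u in T.
    replace (v + p1 * y)%C with X in T by (unfold X, Y, p1; ring).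
    replace (X + RtoC k * (Cconj x * X) * x)%C with (RtoC k * X)%C in T.
    2:{ replace (X + RtoC k * (Cconj x * X) * x)%C with (X * 1 + RtoC k * X * (Cconj x * x))%C by ring.
        rewrite <- HkC, <- Hu. ring. }
    replace (y + p1 * x)%C with (RtoC k * y + x * eta)%C in T.
    2:{ unfold p1. replace (y + (RtoC k * (Cconj x * y) + eta) * x)%C
          with (y * 1 + RtoC k * y * (Cconj x * x) + x * eta)%C by ring.
        rewrite <- HkC, <- Hu. ring. }
    rewrite !Cmod_mult, Cmod_conj, !Cmod_R, (Rabs_pos_eq k) in T by lra.
    replace ((k * (Cmod x * Cmod X)) ^ 2) with (k ^ 2 * (u * Cmod X ^ 2)) in T by (unfold u; ring).
    assert (E : Cmod (RtoC k * y + x * eta) ^ 2 - Cmod p1 ^ 2 =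
      (1 - u) * (k ^ 2 * Cmod y ^ 2 - Cmod eta ^ 2)).
    { unfold p1, u. rewrite !Cmod2_alt. destruct x as [x1 x2], y as [y1 y2], eta as [e1 e2]. simpl. ring. }
    assert (E2 : u + (1 - u) * (k ^ 2 * Cmod y ^ 2 - Cmod eta ^ 2) + k ^ 2 * (1 - u) * Cmod X ^ 2 <= 1).
    { rewrite <- E. replace ((k * Cmod X) ^ 2) with (k ^ 2 * Cmod X ^ 2) in T by ring. lra. }
    replace ((1 - u) * (k ^ 2 * Cmod y ^ 2 - Cmod eta ^ 2))
      with (k * (1 - u) * k * Cmod y ^ 2 - (1 - u) * Cmod eta ^ 2) in E2 by ring.
    replace (k ^ 2 * (1 - u)) with (k * (1 - u) * k) in E2 by ring.
    rewrite Hk, !Rmult_1_l in E2.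
    apply Rmult_le_compat_l with (r := 1 - u) in E2; [|lra].
    replace ((1 - u) * (u + (k * Cmod y ^ 2 - (1 - u) * Cmod eta ^ 2) + k * Cmod X ^ 2))
      with ((1 - u) * u + k * (1 - u) * Cmod y ^ 2 - (1 - u) ^ 2 * Cmod eta ^ 2 + k * (1 - u) * Cmod X ^ 2)
      in E2 by ring.
    rewrite Hk in E2. fold X. nra. }
  set (D := (1 - u) ^ 2 - Cmod y ^ 2) in *.
  assert (HD : 0 <= D).
  { assert (T := Key 0%C). rewrite Cmod_0 in T.
    assert (V := pow2_ge_0 (Cmod (Y + y * 0)%C)). lra. }
  assert (Y0 := Cmod_ge_0 Y). assert (y0 := Cmod_ge_0 y).
  split; [unfold D in HD; nra|].
  (* For D > 0, eta = conj(y) Y / D maximises the left side of [Key], with value |Y|^2 (1 - u)^2 /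
     D. For D = 0, eta = 0 already forces Y = 0. *)
  destruct (Rle_lt_or_eq_dec 0 D HD) as [HD'|HD'].
  - assert (T := Key (RtoC (/ D) * (Cconj y * Y))%C).
    assert (DC : (RtoC (/ D) * RtoC D)%C = 1%C) by (rewrite <- RtoC_mult, Rinv_l by lra; reflexivity).
    replace (Y + y * (RtoC (/ D) * (Cconj y * Y)))%C with (RtoC (/ D * (1 - u) ^ 2) * Y)%C in T.
    2:{ replace (Y + y * (RtoC (/ D) * (Cconj y * Y)))%C with (1 * Y + RtoC (/ D) * (y * Cconj y) * Y)%C by ring.
        rewrite <- DC, <- Cmod2_conj, <- !RtoC_mult, <- Cmult_plus_distr_r, <- RtoC_plus.
        f_equal. f_equal. unfold D at 3. ring. }
    assert (HI : 0 < / D) by (apply Rinv_0_lt_compat, HD').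
    assert (HU : 0 <= (1 - u) ^ 2) by apply pow2_ge_0.
    rewrite !Cmod_mult, Cmod_conj, !Cmod_R, !Rabs_pos_eq in T by (try apply Rmult_le_pos; lra).
    replace ((/ D * (1 - u) ^ 2 * Cmod Y) ^ 2 - (1 - u) ^ 2 * (/ D * (Cmod y * Cmod Y)) ^ 2)
      with (/ D * / D * (Cmod Y * (1 - u)) ^ 2 * ((1 - u) ^ 2 - Cmod y ^ 2)) in T by ring.
    fold D in T.
    replace (/ D * / D * (Cmod Y * (1 - u)) ^ 2 * D) with ((Cmod Y * (1 - u)) ^ 2 * / D) in T by (field; lra).
    apply Rmult_le_compat_r with (r := D) in T; [|lra].
    rewrite Rmult_assoc, Rinv_l, Rmult_1_r in T by lra.
    assert (0 <= Cmod Y * (1 - u)) by (apply Rmult_le_pos; lra). nra.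
  - assert (T := Key 0%C). rewrite <- HD', Cmod_0 in T.
    replace (Y + y * 0)%C with Y in T by ring.
    assert (Cmod Y = 0) by nra. rewrite <- HD'. nra.
Qed.

(** * The extremal problem *)

(* [c = |w_1|], [|w_2| = (1 - u) t], [Re (w_1^2 conj w_2) = (1 - u) R]. For small [u] the maximum over [R] is at [R = u t]; otherwise it is bounded by completing the square in [R], with sqrt ((52 - 16 u) / (9 (3 + u))) <= 1.4 - 0.4 u. *)
Lemma schur_real_bound (c t S R : R) :
  0 <= c < 1 -> 0 <= t <= 1 -> 0 <= S -> Rabs R <= c ^ 2 * t ->
  let u := c ^ 2 in let A := 9 / 4 * u ^ 2 in let T := (1 - u) * (3 + u) * t ^ 2 in
  S ^ 2 = (A + T) ^ 2 + 25 * u ^ 2 * (1 - u) ^ 2 * t ^ 2 + 10 * (T - A) * (1 - u) * R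
          - 9 * (3 + u) * (1 - u) * R ^ 2 ->
  S + 4 * c * (1 - u) * (1 - t ^ 2) <= 36 / 11.
Proof.
  intros Hc Ht HS HR u A T HE.
  assert (Hu : 0 <= u < 1) by (unfold u; nra).
  assert (HR' : - (u * t) <= R <= u * t) by (apply Rabs_le_between; exact HR).
  assert (Hut : 0 <= u * t) by nra.
  assert (H4c : 4 * c <= 3 + u) by (unfold u; nra).
  assert (Ht2 : 0 <= t ^ 2 <= 1) by nra.
  assert (Hu1 : 0 <= (1 - u) * (1 - t ^ 2)) by (apply Rmult_le_pos; lra).
  (* S^2 is a concave quadratic in R with vertex 5 (T - A) / (9 (3 + u)). The cases are whether this
     vertex lies at or beyond the endpoint R = u t. *)
  destruct (Rle_lt_dec (9 * u * (3 + u) * t) (5 * (T - A))) as [HI|HII].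
  - assert (B : S <= T - A + 5 * (1 - u) * (u * t)).
    { assert (P : 0 <= (1 - u) * ((u * t - R) * (10 * (T - A) - 9 * (3 + u) * (u * t + R)))).
      { apply Rmult_le_pos; [lra|]. apply Rmult_le_pos; [lra|].
        assert (9 * (3 + u) * (u * t + R) <= 9 * (3 + u) * (2 * (u * t))) by (apply Rmult_le_compat_l; lra).
        lra. }
      assert (E : (T - A + 5 * (1 - u) * (u * t)) ^ 2 - S ^ 2 =
        (1 - u) * ((u * t - R) * (10 * (T - A) - 9 * (3 + u) * (u * t + R)))).
      { rewrite HE. unfold T, A. field. }
      assert (0 <= 9 * u * (3 + u) * t) by (replace (9 * u * (3 + u) * t) with (9 * (3 + u) * (u * t)) by ring; nra).
      assert (0 <= (1 - u) * (u * t)) by (apply Rmult_le_pos; lra).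
      nra. }
    (* 4c <= 3 + u is (1 - c)(3 - c) >= 0. After it the t^2 terms cancel against T, leaving 3 + 3u -
       (33/4) u^2 = 36/11 - (33/4)(u - 2/11)^2. *)
    assert (B1 : 4 * c * ((1 - u) * (1 - t ^ 2)) <= (3 + u) * ((1 - u) * (1 - t ^ 2)))
      by (apply Rmult_le_compat_r; lra).
    assert (B2 : (1 - u) * (u * t) <= (1 - u) * u) by (apply Rmult_le_compat_l; nra).
    unfold T, A in B.
    assert (0 <= (u - 2 / 11) ^ 2) by apply pow2_ge_0. nra.
  - assert (HA : 0 <= A) by (unfold A; nra).
    assert (HT : 0 <= T) by (unfold T; apply Rmult_le_pos; [apply Rmult_le_pos; lra|lra]).
    assert (B : S <= (14 / 10 - 4 / 10 * u) * (A + T)).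
    { assert (P : 9 * (3 + u) * S ^ 2 <= (52 - 16 * u) * (A + T) ^ 2).
      (* The term 25 u^2 (1-u)^2 t^2 is a multiple of A T and turns the (T - A)^2 from completing
         the square into (T + A)^2; this is why A + T factors out. *)
      { assert (E : (52 - 16 * u) * (A + T) ^ 2 - 9 * (3 + u) * S ^ 2 =
          (1 - u) * (5 * (T - A) - 9 * (3 + u) * R) ^ 2).
        { rewrite HE. unfold T, A. field. }
        assert (0 <= (1 - u) * (5 * (T - A) - 9 * (3 + u) * R) ^ 2)
          by (apply Rmult_le_pos; [lra|apply pow2_ge_0]).
        lra. }
      (* The linear majorant agrees with the square root at u = 1, hence the factor 1 - u below. *)
      assert (Q : 52 - 16 * u <= 9 * (3 + u) * (14 / 10 - 4 / 10 * u) ^ 2).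
      { assert (0 <= (1 - u) * (92 / 100 + 432 / 100 * u - 144 / 100 * u ^ 2))
          by (apply Rmult_le_pos; nra).
        nra. }
      assert (P2 : 9 * (3 + u) * S ^ 2 <= 9 * (3 + u) * (14 / 10 - 4 / 10 * u) ^ 2 * (A + T) ^ 2).
      { eapply Rle_trans; [exact P|]. apply Rmult_le_compat_r; [apply pow2_ge_0|exact Q]. }
      assert (P3 : S ^ 2 <= ((14 / 10 - 4 / 10 * u) * (A + T)) ^ 2).
      { apply Rmult_le_reg_l with (9 * (3 + u)); [lra|]. lra. }
      assert (0 <= (14 / 10 - 4 / 10 * u) * (A + T)) by (apply Rmult_le_pos; lra).
      nra. }
    (* For u >= 0.29 the bound (1.4 - 0.4u)(A + (1-u)(3+u)), free of t, lies below 36/11. At u = 0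
       it is 4.2, so for small u the case hypothesis must first keep t away from 1. *)
    destruct (Rle_lt_dec (29 / 100) u) as [Hu2|Hu2].
    + assert (B1 : 4 * c * ((1 - u) * (1 - t ^ 2)) <= (3 + u) * ((1 - u) * (1 - t ^ 2)))
        by (apply Rmult_le_compat_r; lra).
      assert (B2 : 1 * ((3 + u) * ((1 - u) * (1 - t ^ 2))) <=
        (14 / 10 - 4 / 10 * u) * ((3 + u) * ((1 - u) * (1 - t ^ 2)))).
      { apply Rmult_le_compat_r; [apply Rmult_le_pos; lra|lra]. }
      assert (B3 : S + 4 * c * (1 - u) * (1 - t ^ 2) <=
        (14 / 10 - 4 / 10 * u) * (A + (1 - u) * (3 + u))) by (unfold T in B; nra).
      eapply Rle_trans; [exact B3|]. unfold A.
      assert (0 <= (255 / 100 - u / 2) * ((u - 29 / 100) * (1 - u)))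
        by (apply Rmult_le_pos; [lra|apply Rmult_le_pos; lra]).
      assert (29 / 100 * u <= u ^ 2) by nra. lra.
    (* [HII] reads (3+u) t (5(1-u) t - 9u) < (45/4) u^2. For u < 0.29 and t >= 0.85 the left side is
       smallest at t = 0.85, where it is already too large. *)
    + assert (Ht3 : t < 85 / 100).
      { destruct (Rlt_le_dec t (85 / 100)) as [|Ht3]; [assumption|exfalso].
        assert (K1 : 0 < 425 / 100 * (1 - u) - 9 * u) by lra.
        assert (K2 : 425 / 100 * (1 - u) - 9 * u <= 5 * (1 - u) * t - 9 * u) by nra.
        assert (K3 : (3 + u) * (85 / 100) * (425 / 100 * (1 - u) - 9 * u) <=
          (3 + u) * t * (5 * (1 - u) * t - 9 * u)).
        { apply Rmult_le_compat; [nra|lra|nra|exact K2]. }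
        assert (K4 : 45 / 4 * u ^ 2 < (3 + u) * (85 / 100) * (425 / 100 * (1 - u) - 9 * u)) by nra.
        unfold T, A in HII. nra. }
      (* 2u + 1/8 - c = 2 (c - 1/4)^2, which makes the final estimate polynomial in u. *)
      assert (Hc2 : c <= 2 * u + 1 / 8) by (unfold u; assert (T2 := pow2_ge_0 (c - 1 / 4)); nra).
      assert (Ht4 : t ^ 2 <= 7225 / 10000) by nra.
      assert (B2 : 4 * c * (1 - u) <= (14 / 10 - 4 / 10 * u) * ((1 - u) * (3 + u))).
      { apply Rle_trans with (1 * ((1 - u) * (3 + u))); [nra|].
        apply Rmult_le_compat_r; [nra|lra]. }
      set (k := 4 * c * (1 - u)) in *. set (L := (14 / 10 - 4 / 10 * u) * ((1 - u) * (3 + u))) in *.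
      (* The bound is affine in t^2 with slope L - k >= 0, so t^2 is replaced by 0.85^2 = 0.7225,
         and 1 - t^2 by 0.2775. *)
      assert (B3 : S + k * (1 - t ^ 2) <= (14 / 10 - 4 / 10 * u) * A + L * (7225 / 10000) + k * (2775 / 10000)).
      { replace ((14 / 10 - 4 / 10 * u) * (A + T)) with ((14 / 10 - 4 / 10 * u) * A + L * t ^ 2) in B
          by (unfold L, T; ring).
        assert (0 <= (L - k) * (7225 / 10000 - t ^ 2)) by (apply Rmult_le_pos; lra). nra. }
      assert (B4 : k <= 4 * (2 * u + 1 / 8) * (1 - u)) by (unfold k; nra).
      eapply Rle_trans; [exact B3|]. unfold L, A.
      assert (u ^ 2 <= u) by nra. assert (0 <= u ^ 3) by (apply pow_le; lra). lra.
Qed.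

(** The triangle inequality splits off 4 x Y, the part containing the free third coefficient. What
    is left, [P], depends in modulus only on |x|, |y| and Re(x^2 conj y). *)
Lemma schur_functional_bound (x y v : C) :
  (forall p0 p1 p2 : C,
    Cmod (p0 * x) ^ 2 + Cmod (p0 * y + p1 * x) ^ 2 + Cmod (p0 * v + p1 * y + p2 * x) ^ 2 <=
    Cmod p0 ^ 2 + Cmod p1 ^ 2 + Cmod p2 ^ 2) ->
  Cmod (9 / 4 * (x * x * x * x) - 5 * (x * x * y) - 3 * (y * y) + 4 * (x * v)) <= 36 / 11.
Proof.
  intros H. set (c := Cmod x). assert (Hc : 0 <= c) by apply Cmod_ge_0.
  assert (H1 := H 1%C 0%C 0%C).
  replace (1 * y + 0 * x)%C with y in H1 by ring.
  replace (1 * v + 0 * y + 0 * x)%C with v in H1 by ring.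
  rewrite Cmult_1_l, Cmod_1, Cmod_0 in H1. fold c in H1.
  assert (y0 := pow2_ge_0 (Cmod y)). assert (v0 := pow2_ge_0 (Cmod v)).
  assert (Hc1 : c <= 1) by nra.
  (* If |x| = 1 the contraction leaves no room: y = v = 0 and the value is 9/4. Otherwise division
     by 1 - u is possible. *)
  destruct (Req_dec c 1) as [Hc2|Hc2].
  - rewrite Hc2 in H1.
    assert (Hy : y = 0%C) by (apply Cmod_eq_0; nra). assert (Hv : v = 0%C) by (apply Cmod_eq_0; nra).
    rewrite Hy, Hv.
    replace (9 / 4 * (x * x * x * x) - 5 * (x * x * 0) - 3 * (0 * 0) + 4 * (x * 0))%C
      with (RtoC (9 / 4) * (x * x * x * x))%C by (rewrite RtoC_div by lra; ring).
    rewrite !Cmod_mult, Cmod_R, Rabs_pos_eq by lra. fold c. rewrite Hc2. lra.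
  - assert (Hx : Cmod x ^ 2 < 1) by (fold c; nra).
    destruct (toeplitz_contraction_schur x y v H Hx) as [Hy HY].
    fold c in Hy, HY, Hx. set (u := c ^ 2) in *.
    assert (Hu : 0 <= u) by apply pow2_ge_0.
    set (Y := (v + / RtoC (1 - u) * (Cconj x * (y * y)))%C) in *.
    set (m := Cmod y) in *. set (t := m / (1 - u)).
    assert (Hm : m = (1 - u) * t) by (unfold t; field; lra).
    assert (Hm0 : 0 <= m) by apply Cmod_ge_0.
    assert (Ht : 0 <= t <= 1) by (split; nra).
    (* Writing v through Y adds -4u/(1-u) to the coefficient -3 of y^2, which becomes
       -(3+u)/(1-u). *)
    set (kap := (3 + u) / (1 - u)).
    assert (HuC : RtoC u = (x * Cconj x)%C) by (unfold u, c; apply Cmod2_conj).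
    assert (HnC : RtoC (1 - u) <> 0%C) by (intros E; apply RtoC_inj in E; lra).
    set (P := (9 / 4 * ((x * x) * (x * x)) - 5 * ((x * x) * y) - RtoC kap * (y * y))%C).
    replace (9 / 4 * (x * x * x * x) - 5 * (x * x * y) - 3 * (y * y) + 4 * (x * v))%C
      with (P + 4 * x * Y)%C.
    2:{ unfold P, Y, kap. rewrite RtoC_div, RtoC_plus by lra.
        replace (4 * x * (v + / RtoC (1 - u) * (Cconj x * (y * y))))%C
          with (4 * x * v + 4 * (x * Cconj x) * / RtoC (1 - u) * (y * y))%C by ring.
        rewrite <- HuC. rewrite RtoC_minus in *. field. exact HnC. }
    eapply Rle_trans; [apply Cmod_triangle|].
    assert (B1 : Cmod (4 * x * Y) <= 4 * c * (1 - u) * (1 - t ^ 2)).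
    { rewrite !Cmod_mult, Cmod_R, Rabs_pos_eq by lra. fold c.
      assert (HY' : Cmod Y <= (1 - u) * (1 - t ^ 2)).
      { apply Rmult_le_reg_r with (1 - u); [lra|]. eapply Rle_trans; [exact HY|].
        rewrite Hm. right; ring. }
      assert (4 * c * Cmod Y <= 4 * c * ((1 - u) * (1 - t ^ 2))) by (apply Rmult_le_compat_l; lra).
      lra. }
    set (R0 := fst (x * x * Cconj y)%C).
    assert (HR0 : Rabs R0 <= u * m).
    { eapply Rle_trans; [apply fst_le_Cmod|]. rewrite !Cmod_mult, Cmod_conj. fold c m. unfold u. right; ring. }
    set (R := R0 / (1 - u)). assert (HR : R0 = (1 - u) * R) by (unfold R; field; lra).
    assert (B2 : Cmod P + 4 * c * (1 - u) * (1 - t ^ 2) <= 36 / 11).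
    { apply (schur_real_bound c t (Cmod P) R); [lra|exact Ht|apply Cmod_ge_0| |].
      - fold u. apply Rmult_le_reg_l with (1 - u); [lra|].
        rewrite <- (Rabs_pos_eq (1 - u)) at 1 by lra. rewrite <- Rabs_mult, <- HR.
        eapply Rle_trans; [exact HR0|]. rewrite Hm. right; ring.
      - fold u.
        assert (E : Cmod P ^ 2 = (9 / 4 * u ^ 2 + kap * m ^ 2) ^ 2 + 25 * u ^ 2 * m ^ 2
          + 10 * (kap * m ^ 2 - 9 / 4 * u ^ 2) * R0 - 9 * kap * R0 ^ 2).
        { unfold P, R0, m, u, c. generalize kap. intros q.
          rewrite !Cmod2_alt. destruct x as [x1 x2], y as [y1 y2]. simpl. field. }
        rewrite E, HR, Hm. unfold kap. field. lra. }
    lra.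
Qed.

Theorem theorem3p2 :
  (forall (f : C -> C) (a : nat -> C),
     Sch f ->
     (forall z, inD z -> is_pseries a z (f z)) ->
     Cmod (H21 a) =
       / 48 * Cmod (13 * (a 2%nat * a 2%nat * a 2%nat * a 2%nat)
                    - 12 * (a 2%nat * a 2%nat * a 3%nat)
                    - 12 * (a 3%nat * a 3%nat)
                    + 12 * (a 2%nat * a 4%nat))%C
     /\ Cmod (H21 a) <= 3 / 44)
  /\
  (exists (f : C -> C) (a : nat -> C),
     Sch f /\ (forall z, inD z -> is_pseries a z (f z)) /\
     Cmod (H21 a) = 3 / 44).
Proof.
  split.
  - intros f a [[_ [F0 F1]] [om [[w Hw] [O0 [O1 HE]]]]] Ha.
    apply has_pseries_iff in Ha. apply has_pseries_iff in Hw. apply is_derive_cderiv in F1.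
    split; [apply Cmod_H21|].
    assert (W0 : w O = 0%C) by (rewrite <- O0; symmetry; apply has_pseries_at_0, Hw).
    destruct (starlike_coef f a w om Ha F0 F1 Hw O0) as [E2 [E3 E4]].
    + intros z d Hz Hz0 Hd. destruct (HE z Hz Hz0) as [Fz [d' [Hd' E]]].
      apply is_derive_cderiv in Hd'. rewrite (cderiv_unique _ _ _ _ Hd Hd'), <- E.
      field. exact Fz.
    + rewrite (H21_starlike a w E2 E3 E4), Cmod_mult, <- RtoC_inv, Cmod_R, Rabs_pos_eq by lra.
      assert (T := schur_functional_bound _ _ _ (schur_toeplitz_contraction w om Hw W0 O1)). lra.
  - destruct extremal_Sch as [f [a [Hf [Ha E]]]].
    exists f, a. split; [exact Hf|split; [apply has_pseries_iff, Ha|exact E]].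
Qed.
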